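(* Suppose $X$ is sub-Gaussian with constant $C_1$ and that $\lambda_d-\lambda_{d+1}\ge c_1(\lambda_d-\lambda_p)$ with some $c_1>0$. For $s\in\{1,\dots,d\}$ consider the condition $$(\ast)_s\qquad \frac{\lambda_s}{\lambda_s-\lambda_{d+1}}\sum_{j\le s}\frac{\lambda_j}{\lambda_j-\lambda_{d+1}}\le\frac{n}{16C_3^2}.$$ There is a constant $C>0$ depending only on $C_1$ such that the following holds. If $(\ast)_s$ holds with $s=d$, then we have the local bound $$\mathbb E[\mathcal E^{PCA}_d]\le\frac{C}{c_1n}\Big(\operatorname{tr}_{>d}(\Sigma)+\operatorname{tr}(\Sigma)e^{-c_1^2n(\lambda_d-\lambda_p)^2/(C\lambda_d^2)}\Big)\sum_{j\le d}\frac{\lambda_j}{\lambda_j-\lambda_{d+1}}.$$ Moreover, if $s\le d$ is the largest number such that $(\ast)_s$ is satisfied (and $s=0$ if such a number does not exist), then we have the global bound $$\mathbb E[\mathcal E^{PCA}_d]\le\frac{C}{c_1\sqrt n}\bigg(\sqrt{\operatorname{tr}_{>s}(\Sigma)}+\sqrt{\operatorname{tr}(\Sigma)}\,e^{-c_1^2n(\lambda_s-\lambda_p)^2/(C\lambda_s^2)}\bigg)\sum_{j\le d}\sqrt{\lambda_j}.$$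
   Context: Let $(\mathcal H,\langle\cdot,\cdot\rangle)$ be a separable real Hilbert space of dimension $p\in\mathbb N\cup\{+\infty\}$ with norm $\|\cdot\|$, and let $X$ be a centered $\mathcal H$-valued random variable with $\mathbb E\|X\|^2<\infty$. Its covariance operator is $\Sigma=\mathbb E[X\otimes X]$, where $(u\otimes v)x=\langle v,x\rangle u$. Its eigenvalues (with multiplicity) are $\lambda_1\ge\lambda_2\ge\dots>0$, with corresponding eigenvectors $u_1,u_2,\dots$ which are assumed to form an orthonormal basis of $\mathcal H$ and are fixed; $P_j=u_j\otimes u_j$, $P_{\le d}=\sum_{j\le d}P_j$. Put $\operatorname{tr}_{>r}(\Sigma)=\sum_{j>r}\lambda_j$. For $p=\infty$ one understands $\lambda_p=0$. Let $X_1,\dots,X_n$ be $n\ge1$ independent copies of $X$, $\hat\Sigma=\frac1n\sum_{i=1}^nX_i\otimes X_i$, with eigenvalues $\hat\lambda_1\ge\hat\lambda_2\ge\dots\ge0$ and an orthonormal basis of eigenvectors $\hat u_1,\hat u_2,\dots$; $\hat P_j=\hat u_j\otimes\hat u_j$, $\hat P_{\le d}=\sum_{j\le d}\hat P_j$. Here $d$ is an integer with $1\le d<p$; $\|\cdot\|_\infty$ is the operator norm. The excess risk is $\mathcal E^{PCA}_d=\langle\Sigma,P_{\le d}-\hat P_{\le d}\rangle$ with $\langle S,T\rangle=\operatorname{tr}(S^*T)$. $X$ is sub-Gaussian with constant $C_1$ if $\mathbb E\|X\|^2<\infty$ and $\sup_{k\ge1}k^{-1/2}\mathbb E[|\langle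 X,u\rangle|^k]^{1/k}\le C_1\mathbb E[\langle X,u\rangle^2]^{1/2}$ for all $u\in\mathcal H$. $C_3>1$ is a constant depending only on $C_1$ such that for every centered sub-Gaussian random variable with constant $C_1$ in a separable Hilbert space, with covariance $\Sigma$, largest eigenvalue $\lambda_1$ of $\Sigma$, and sample covariance $\hat\Sigma$ from $n$ independent copies, one has $\mathbb P(\|\Sigma-\hat\Sigma\|_\infty>C_3\lambda_1x)\le e^{-n(x\wedge x^2)}$ whenever $x>0$ and $\operatorname{tr}(\Sigma)\le n\lambda_1(x\wedge x^2)$ (the existence of such $C_3$ is a known theorem of Koltchinskii and Lounici). Conventions: $x/0:=\infty$ for $x>0$, so that $(\ast)_s$ presupposes $\lambda_s>\lambda_{d+1}$. If $s=0$, the second (exponential) term in the parentheses of the global bound is omitted and $\operatorname{tr}_{>0}(\Sigma)=\operatorname{tr}(\Sigma)$.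
   Formalization: The formal theorem adds c_1 ≤ 1; the gap assumption implies this unless p is finite and λ_d = λ_p, where every c_1 > 0 satisfies it and the global bound fails as c_1 → ∞ (e.g. p=3, d=2, eigenvalues 2,1,1, X Gaussian, n≥2). *)

(* Defs.v *)
From HB Require Import structures.
From mathcomp Require Import all_boot all_order all_algebra.
From mathcomp Require Import all_classical all_reals all_analysis.

Set Implicit Arguments.
Unset Strict Implicit.
Unset Printing Implicit Defensive.

Import Order.TTheory GRing.Theory Num.Theory.
Import numFieldNormedType.Exports.

Local Open Scope classical_set_scope.
Local Open Scope ring_scope.

HB.mixin Record NormedModule_isHilbert (R : realType) H
    & CompleteNormedModule R H := {
  inner : {dot H for (@idfun R)} ;
  inner_norm : forall x : H, inner x x = `|x| ^+ 2
}.

#[short(type="hilbertType")]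
HB.structure Definition Hilbert (R : realType) :=
  {H of NormedModule_isHilbert R H & CompleteNormedModule R H}.

Section Operators.
Context (R : realType) (H : hilbertType R).
Implicit Types (p : option nat) (e : nat -> H) (S T : H -> H).

Definition separable := exists2 D : set H, countable D & dense D.

Definition tensor (u v : H) : H -> H := fun x => inner v x *: u.

(* A dimension is an [option nat], where [None] stands for infinity.  All
   eigenvalues and basis vectors are indexed from 1 (the value at 0 is never
   used), so the indices in use are the j with 1 <= j <= p. *)
Definition in_dim p (j : nat) : bool :=
  (1 <= j)%N && (if p is Some q then (j <= q)%N else true).

Definition is_onb p e :=
  (forall i j, in_dim p i -> in_dim p j -> inner (e i) (e j) = (i == j)%:R) /\
  (forall x : H,
    (\sum_(1 <= j < N.+1 | in_dim p j) inner (e j) x *: e j) @[N --> \oo] --> x).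

Definition is_eigenvalue S (l : R) := exists2 v : H, v != 0 & S v = l *: v.

Definition is_largest_eigenvalue S (l : R) :=
  is_eigenvalue S l /\ (forall m, is_eigenvalue S m -> m <= l).

(* An eigenbasis of S adapted to its eigenvalues in nonincreasing order;
   eigenvalues are thereby listed with multiplicity. *)
Definition is_eigensystem p S (lam : nat -> R) e :=
  [/\ is_onb p e,
      (forall j, in_dim p j -> S (e j) = lam j *: e j) &
      (forall i j, in_dim p i -> in_dim p j -> (i <= j)%N -> lam j <= lam i)].

Definition opnorm T : \bar R :=
  ereal_sup [set `|T x|%:E | x in [set x : H | `|x| <= 1]].

(* Trace of a positive operator, with value +oo when it is not trace class. *)
Definition trace p e S : \bar R :=
  (\sum_(1 <= j <oo | in_dim p j) (inner (e j) (S (e j)))%:E)%E.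

(* tr (S^* T) = sum_j <e_j, S^* T e_j> = sum_j <S e_j, T e_j> *)
Definition hs_inner p e S T : R :=
  limn (fun N => \sum_(1 <= j < N.+1 | in_dim p j) inner (S (e j)) (T (e j))).

Definition proj_le e (d : nat) : H -> H :=
  fun x => \sum_(1 <= j < d.+1) tensor (e j) (e j) x.

End Operators.

Section Spectrum.
Context (R : realType).
Implicit Types (p : option nat) (lam : nat -> R).

Definition eig_last p lam : R := if p is Some q then lam q else 0.

Definition tr_gt p lam (r : nat) : \bar R :=
  (\sum_(r.+1 <= j <oo | in_dim p j) (lam j)%:E)%E.

Definition gap_sum lam (d s : nat) : R :=
  \sum_(1 <= j < s.+1) lam j / (lam j - lam d.+1).

(* The first conjunct encodes the convention x / 0 = oo, as x / 0 = 0 in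
   MathComp. *)
Definition gap_cond (C3 : R) (n : nat) lam (d s : nat) : Prop :=
  lam d.+1 < lam s /\
  lam s / (lam s - lam d.+1) * gap_sum lam d s <= n%:R / (16 * C3 ^+ 2).

Definition is_largest_index (Q : nat -> Prop) (d s : nat) : Prop :=
  [/\ (s <= d)%N,
      ((0 < s)%N -> Q s) &
      (forall t, (1 <= t <= d)%N -> Q t -> (t <= s)%N)].

End Spectrum.

Definition borel (R : realType) (H : hilbertType R) :=
  g_sigma_algebraType (@open H).

Section Probability.
Context (R : realType) (H : hilbertType R).
Context (d : measure_display) (Om : measurableType d) (P : probability Om R).

(* m is the weak (Pettis) expectation of Y. *)
Definition is_mean (Y : Om -> H) (m : H) :=
  forall v : H, (inner m v)%:E = 'E_P[fun w => inner (Y w) v]%E.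

Definition is_covariance (X : Om -> H) (S : H -> H) :=
  forall x : H, is_mean (fun w => tensor (X w) (X w) x) (S x).

Definition sq_integrable (X : Om -> H) := ('E_P[fun w => (`|X w| ^+ 2)%R] < +oo)%E.

Definition sub_gaussian (C1 : R) (X : Om -> H) :=
  sq_integrable X /\
  forall u : H,
    (ereal_sup [set (k%:R `^ (- 2^-1))%R%:E *
                    'E_P[fun w => (`| inner (X w) u | ^+ k)%R] `^ (k%:R^-1)%R
               | k in [set k : nat | (1 <= k)%N]]
     <= C1%:E * 'E_P[fun w => (inner (X w) u ^+ 2)%R] `^ (2^-1)%R)%E.

Definition mutually_independent (n : nat) (Xs : 'I_n -> {RV P >-> borel H}) :=
  forall (J : {set 'I_n}) (A : 'I_n -> set (borel H)),
    (forall i, i \in J -> measurable (A i)) ->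
    P (\bigcap_(i in [set` J]) (Xs i @^-1` A i)) =
    (\prod_(i in J) P (Xs i @^-1` A i))%E.

Definition iid_copies (X : {RV P >-> borel H}) (n : nat)
    (Xs : 'I_n -> {RV P >-> borel H}) :=
  mutually_independent Xs /\
  forall i (A : set (borel H)), measurable A ->
    distribution P (Xs i) A = distribution P X A.

Definition emp_cov (n : nat) (Xs : 'I_n -> {RV P >-> borel H}) (w : Om) :
    H -> H :=
  fun x => n%:R^-1 *: \sum_(i < n) tensor (Xs i w : H) (Xs i w : H) x.

End Probability.

Arguments is_mean {R H d Om} P Y m.
Arguments is_covariance {R H d Om} P X S.
Arguments sq_integrable {R H d Om} P X.
Arguments sub_gaussian {R H d Om} P C1 X.

(* The trace does not depend on the orthonormal basis e. *)
Definition is_concentration_constant (R : realType) (C1 C3 : R) : Prop :=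
  forall (H : hilbertType R), separable H ->
  forall (p : option nat) (e : nat -> H), is_onb p e ->
  forall (d : measure_display) (Om : measurableType d) (P : probability Om R)
         (X : {RV P >-> borel H}) (S : H -> H) (l1 : R),
  is_mean P X 0 -> sub_gaussian P C1 X -> is_covariance P X S ->
  is_largest_eigenvalue S l1 ->
  forall (n : nat) (Xs : 'I_n -> {RV P >-> borel H}),
  (1 <= n)%N -> iid_copies X Xs ->
  forall x : R, 0 < x ->
  (trace p e S <= (n%:R * l1 * Num.min x (x ^+ 2))%:E)%E ->
  (P [set w | (C3 * l1 * x)%:E < opnorm (S \- emp_cov Xs w)%R]
     <= (expR (- (n%:R * Num.min x (x ^+ 2))))%:E)%E.

Definition excess_risk (R : realType) (H : hilbertType R) (p : option nat)
    (u : nat -> H) (S : H -> H) (uhat : nat -> H) (d : nat) : R :=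
  hs_inner p u S (proj_le u d \- proj_le uhat d).

(* Main.v *)
Require Import Defs.
From HB Require Import structures.
From mathcomp Require Import all_boot all_order all_algebra.
From mathcomp Require Import all_classical all_reals all_analysis.
From mathcomp Require Import ring lra measurable_realfun.

Import Order.TTheory GRing.Theory Num.Theory.
Import numFieldNormedType.Exports.

Local Open Scope classical_set_scope.
Local Open Scope ring_scope.

(** Write [gap j] for [lam j - lam d.+1], [D] for the difference of the covariance
    operator and its empirical version, and [E] for the projection onto the orthogonal
    complement of the first [d] empirical eigenvectors.  The excess risk is at most
    [sum_(j <= d) (lam j - lam_p) |E u_j|^2], hence at most [1 / c1] times
    [sum_(j <= d) gap j |E u_j|^2] by the assumption on the gaps.

    If the norm of [D] compressed to the span of [u_(d+1), u_(d+2), ...] is at most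
    [gap j / 2], a min-max argument keeps the empirical eigenvalue of index [d+1]
    below [lam j - gap j / 2], and then [gap j |E u_j| <= 2 |E D u_j|].  If it is not,
    either the trivial bound [|E u_j| <= 1] suffices or the event is exponentially
    unlikely.  Splitting [D u_j] into its components on [u_1, ..., u_s] and on the
    remaining basis vectors, the sum over [j <= s] of the first components (divided by
    [gap j]) is at most [1 / 16] of the quantity to be bounded as soon as the operator
    [D], weighted by [gap^(-1/2)] on both sides, has norm at most [1 / 4]; the condition
    on [s] is precisely what the concentration inequality needs for this event.  The
    other components contribute [tr_(> s)], and on the exceptional event one loses
    [tr] times its probability.  The moments of the entries of [D] are also read off
    from the concentration inequality, applied to a two-dimensional image of [X].  For
    [s < j <= d] the failure of the condition bounds [gap j] deterministically. *)

(** * Inner products, orthonormal expansions and symmetric operators *)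

Section InnerProduct.
Context {R : realType} {H : hilbertType R}.
Implicit Types (x y z v w : H) (a b : R).

Lemma innerC x y : inner x y = inner y x.
Proof. by rewrite hermitian_subproof expr0 mul1r. Qed.

Lemma innerDl x y z : inner (x + y) z = inner x z + inner y z.
Proof. exact: linearDl. Qed.

Lemma innerDr x y z : inner x (y + z) = inner x y + inner x z.
Proof. by rewrite innerC innerDl !(innerC _ x). Qed.

Lemma innerZl a x y : inner (a *: x) y = a * inner x y.
Proof. exact: linearZl_LR. Qed.

Lemma innerZr a x y : inner x (a *: y) = a * inner x y.
Proof. by rewrite innerC innerZl innerC. Qed.

Lemma innerNl x y : inner (- x) y = - inner x y.
Proof. by rewrite -scaleN1r innerZl mulN1r. Qed.

Lemma innerNr x y : inner x (- y) = - inner x y.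
Proof. by rewrite innerC innerNl innerC. Qed.

Lemma innerBl x y z : inner (x - y) z = inner x z - inner y z.
Proof. by rewrite innerDl innerNl. Qed.

Lemma innerBr x y z : inner x (y - z) = inner x y - inner x z.
Proof. by rewrite innerDr innerNr. Qed.

Lemma inner0l x : inner 0 x = 0.
Proof. by rewrite -(scale0r x) innerZl mul0r. Qed.

Lemma inner0r x : inner x 0 = 0.
Proof. by rewrite innerC inner0l. Qed.

Lemma inner_suml I (r : seq I) (P : pred I) (F : I -> H) x :
  inner (\sum_(i <- r | P i) F i) x = \sum_(i <- r | P i) inner (F i) x.
Proof.
apply: (big_morph (fun y => inner y x)) => [u v|]; first exact: innerDl.
exact: inner0l.
Qed.

Lemma inner_sumr I (r : seq I) (P : pred I) (F : I -> H) x :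
  inner x (\sum_(i <- r | P i) F i) = \sum_(i <- r | P i) inner x (F i).
Proof. by rewrite innerC inner_suml; apply: eq_bigr => i _; rewrite innerC. Qed.

Lemma inner_ge0 x : 0 <= inner x x.
Proof. by rewrite inner_norm sqr_ge0. Qed.

Lemma inner_ext x y : (forall v, inner x v = inner y v) -> x = y.
Proof.
move=> xy; apply/eqP; rewrite -subr_eq0 -normr_eq0 -sqrf_eq0 -inner_norm.
by rewrite innerBl xy subrr.
Qed.

Lemma ler_inner_norm x y : `|inner x y| <= `|x| * `|y|.
Proof.
have [->|y0] := eqVneq y 0; first by rewrite inner0r !normr0 mulr0.
have ny0 : 0 < `|y| by rewrite normr_gt0.
(* The vector is the component of [x] orthogonal to [y]; its squared norm is
   [|x|^2 - <x, y>^2 / |y|^2]. *)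
have := inner_ge0 (x - (inner x y / `|y| ^+ 2) *: y).
rewrite !(innerBl, innerBr, innerZl, innerZr) !inner_norm (innerC y x).
set c := inner x y; have -> : `|x| ^+ 2 - c / `|y| ^+ 2 * c -
  (c / `|y| ^+ 2 * c - c / `|y| ^+ 2 * (c / `|y| ^+ 2 * `|y| ^+ 2)) =
  `|x| ^+ 2 - c ^+ 2 / `|y| ^+ 2.
  by field; rewrite gt_eqF.
rewrite subr_ge0 ler_pdivrMr ?exprn_gt0// => h.
rewrite -(@ler_pXn2r _ 2)// ?nnegrE ?mulr_ge0//.
by rewrite exprMn -normrX ger0_norm ?sqr_ge0.
Qed.

Lemma cvg_innerl {T} {F : set_system T} {FF : Filter F} {f : T -> H} {x} y :
  f @ F --> x -> inner (f t) y @[t --> F] --> inner x y.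
Proof.
move=> fx.
have hx : (fun t => `|f t - x| * `|y|) @ F --> (0 : R).
  rewrite -(mul0r `|y|); apply: cvgMl; rewrite -(@normr0 _ H) -(subrr x).
  by apply: cvg_norm; apply: cvgB => //; exact: cvg_cst.
have h : (fun t => inner (f t) y - inner x y) @ F --> (0 : R).
  apply/cvgr0Pnorm_le => e e0.
  move/cvgr0Pnorm_le: hx => /(_ _ e0); apply: filterS => t.
  rewrite ger0_norm ?mulr_ge0//; apply: le_trans.
  by rewrite -innerBl ler_inner_norm.
have -> : (fun t => inner (f t) y) =
          (fun t => (inner (f t) y - inner x y) + inner x y).
  by apply/funext => t; rewrite subrK.
by rewrite -[X in _ --> X]add0r; apply: cvgD => //; exact: cvg_cst.
Qed.

Lemma continuous_innerl y : continuous (fun x => inner x y).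
Proof. by move=> x; apply: cvg_innerl; exact: cvg_id. Qed.

Lemma inner_sqr_le x y : inner x y <= (inner x x + inner y y) / 2.
Proof.
by have := inner_ge0 (x - y); rewrite !(innerBl, innerBr) (innerC y x); lra.
Qed.

Lemma normD_sqr_le x y : `|x + y| ^+ 2 <= 2 * `|x| ^+ 2 + 2 * `|y| ^+ 2.
Proof.
have := inner_sqr_le x y.
by rewrite -!inner_norm !(innerDl, innerDr) (innerC y x); lra.
Qed.

End InnerProduct.

Lemma cvg_ext {T T' : Type} {F : set_system T} {f g : T -> T'}
  {l : set_system T'} : f =1 g -> f @ F --> l -> g @ F --> l.
Proof. by move=> /funext ->. Qed.

Section Orthonormal.
Context {R : realType} {H : hilbertType R} (p : option nat).
Implicit Types (e : nat -> H) (x y v : H).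

Lemma in_dim_le {i j : nat} : (1 <= i)%N -> (i <= j)%N -> in_dim p j -> in_dim p i.
Proof.
rewrite /in_dim => i1 ij /andP[j1]; rewrite i1/=.
by case: p => // q; exact: leq_trans.
Qed.

Lemma in_dim_gt0 {j : nat} : in_dim p j -> (0 < j)%N.
Proof. by case/andP. Qed.

Lemma big_nat_in_dim (V : nmodType) (F : nat -> V) (d : nat) : in_dim p d ->
  \sum_(1 <= j < d.+1 | in_dim p j) F j = \sum_(1 <= j < d.+1) F j.
Proof.
move=> pd; rewrite big_nat_cond [RHS]big_nat_cond; apply: eq_bigl => j.
case: (boolP (1 <= j < d.+1)%N) => //= /andP[j1 jd].
by rewrite (in_dim_le j1 _ pd).
Qed.

Section Expansion.
Context {e : nat -> H} (e_onb : is_onb p e).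

Lemma onb_expand_inner x y :
  (\sum_(1 <= j < N.+1 | in_dim p j) inner (e j) x * inner (e j) y)
    @[N --> \oo] --> inner x y.
Proof.
apply: cvg_ext (cvg_innerl y (e_onb.2 x)) => N.
by rewrite inner_suml; apply: eq_bigr => j _; rewrite innerZl.
Qed.

Lemma parseval_cvg x :
  (\sum_(1 <= j < N.+1 | in_dim p j) inner (e j) x ^+ 2)
    @[N --> \oo] --> `|x| ^+ 2.
Proof.
by rewrite -inner_norm; exact: onb_expand_inner.
Qed.

Lemma nondecreasing_sum_nat (F : nat -> R) (m : nat) (P : pred nat) :
  (forall j, P j -> 0 <= F j) ->
  nondecreasing_seq (fun N => \sum_(m <= j < N.+1 | P j) F j).
Proof.
move=> F0; apply/nondecreasing_seqP => N.
have [mN|Nm] := leqP m N.+1; last first.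
  by rewrite !big_geq//; exact: ltnW.
rewrite [leRHS](big_cat_nat (n := N.+1))//= lerDl.
by apply: sumr_ge0.
Qed.

Lemma bessel (N : nat) x :
  \sum_(1 <= j < N.+1 | in_dim p j) inner (e j) x ^+ 2 <= `|x| ^+ 2.
Proof.
have h := parseval_cvg x.
rewrite -(cvg_lim _ h)//.
apply: (nondecreasing_cvgn_le _ _ N); last by apply/cvg_ex; exists (`|x| ^+ 2).
by apply: nondecreasing_sum_nat => j _; exact: sqr_ge0.
Qed.

Lemma parseval x :
  (\sum_(1 <= j <oo | in_dim p j) (inner (e j) x ^+ 2)%:E = (`|x| ^+ 2)%:E)%E.
Proof.
apply/cvg_lim => //; rewrite -cvg_shiftS; apply: cvg_EFin.
  by apply: nearW => N /=; rewrite sumEFin.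
by apply: cvg_ext (parseval_cvg x) => N /=; rewrite sumEFin.
Qed.

Lemma onb_ext x y : (forall j, in_dim p j -> inner (e j) x = inner (e j) y) ->
  x = y.
Proof.
move=> xy; apply/eqP; rewrite -subr_eq0 -normr_eq0 -sqrf_eq0.
rewrite -(cvg_lim _ (parseval_cvg (x - y)))//.
rewrite (_ : (fun N => _) = cst 0) ?lim_cst//.
by apply/funext => N; rewrite big1// => j jp; rewrite innerBr xy// subrr expr0n.
Qed.
End Expansion.
End Orthonormal.

(** This identity alone forces linearity, as testing against all vectors shows. Boundedness is
    obtained separately, from the eigenvalues or from the sample. *)
Definition symmetric_op {R : realType} {H : hilbertType R} (S : H -> H) :=
  forall x y, inner (S x) y = inner x (S y).

Section Symmetric.
Context {R : realType} {H : hilbertType R} {S : H -> H}.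
Hypothesis S_sym : symmetric_op S.

Lemma symmetric_opP a x y : S (a *: x + y) = a *: S x + S y.
Proof.
apply: inner_ext => v.
by rewrite S_sym !(innerDl, innerZl) !S_sym.
Qed.

Lemma symmetric_opZ a x : S (a *: x) = a *: S x.
Proof. by apply: inner_ext => v; rewrite S_sym !innerZl S_sym. Qed.

Lemma symmetric_opB x y : S (x - y) = S x - S y.
Proof. by apply: inner_ext => v; rewrite S_sym !innerBl !S_sym. Qed.

Lemma symmetric_op_sum I (r : seq I) (P : pred I) (F : I -> H) :
  S (\sum_(i <- r | P i) F i) = \sum_(i <- r | P i) S (F i).
Proof.
apply: inner_ext => v.
by rewrite S_sym !inner_suml; apply: eq_bigr => i _; rewrite S_sym.
Qed.

End Symmetric.

(** * Orthogonal projections and eigenvalue expansions *)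

Section Projection.
Context {R : realType} {H : hilbertType R} {p : option nat} {e : nat -> H}.
Hypothesis e_onb : is_onb p e.
Context {d : nat}.
Hypothesis pd : in_dim p d.+1.

Let Q := proj_le e d.

Lemma in_dim_lt {j} : (0 < j)%N -> (j <= d)%N -> in_dim p j.
Proof. by move=> j0 jd; apply: (in_dim_le p j0 _ pd); exact: leqW. Qed.

Lemma in_dim_nat {j} : (1 <= j < d.+1)%N -> in_dim p j.
Proof. by move=> /andP[j0 jd]; exact: in_dim_lt. Qed.

Lemma inner_projl x y :
  inner (Q x) y = \sum_(1 <= j < d.+1) inner (e j) x * inner (e j) y.
Proof.
by rewrite /Q /proj_le inner_suml; apply: eq_bigr => j _; rewrite innerZl.
Qed.

Lemma proj_symmetric : symmetric_op Q.
Proof.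
move=> x y; rewrite inner_projl (innerC x) inner_projl.
by apply: eq_bigr => j _; rewrite mulrC.
Qed.

Lemma inner_proj j x : in_dim p j ->
  inner (e j) (Q x) = (j <= d)%:R * inner (e j) x.
Proof.
move=> pj; rewrite innerC inner_projl.
have [jd|dj] := leqP j d.
- rewrite (bigD1_seq j) ?iota_uniq ?mem_index_iota ?in_dim_gt0//=; last first.
    by rewrite (in_dim_gt0 _ pj).
  rewrite big_nat_cond big1 ?addr0 ?e_onb.1// ?eqxx ?mul1r ?mulr1//.
  move=> i /andP[/in_dim_nat pi ij].
  by rewrite (e_onb.1 _ _ pi pj) (negbTE ij) mulr0.
- rewrite mul0r big_nat_cond big1// => i /andP[/[dup] id /in_dim_nat pi _].
  have /ltn_eqF ij : (i < j)%N by apply: leq_trans dj; case/andP: id.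
  by rewrite e_onb.1// ij mulr0.
Qed.

Lemma proj_idem x : Q (Q x) = Q x.
Proof.
apply: (onb_ext _ e_onb) => j pj; rewrite !inner_proj// mulrA -natrM mulnb.
by rewrite andbb.
Qed.

Lemma norm_proj_compl x :
  `|x - Q x| ^+ 2 = `|x| ^+ 2 - \sum_(1 <= j < d.+1) inner (e j) x ^+ 2.
Proof.
have QQ : inner (Q x) (Q x) = inner (Q x) x.
  by rewrite proj_symmetric proj_idem innerC.
rewrite -!inner_norm innerBl !innerBr QQ subrr subr0 (innerC x).
by rewrite inner_projl.
Qed.

Lemma norm_proj_compl_le x : `|x - Q x| <= `|x|.
Proof.
rewrite -(@ler_pXn2r _ 2)// ?nnegrE// norm_proj_compl gerBl.
by apply: sumr_ge0 => j _; exact: sqr_ge0.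
Qed.

Lemma proj_compl_orth j x : (0 < j)%N -> (j <= d)%N -> inner (e j) (x - Q x) = 0.
Proof.
by move=> j0 jd; rewrite innerBr inner_proj ?in_dim_lt// jd mul1r subrr.
Qed.

End Projection.

Section Eigensystem.
Context {R : realType} {H : hilbertType R} {p : option nat}.
Context {S : H -> H} {lam : nat -> R} {e : nat -> H}.
Hypotheses (S_sym : symmetric_op S) (S_eig : is_eigensystem p S lam e).

Let e_onb : is_onb p e. Proof. by case: S_eig. Qed.

Lemma eigen_inner j x : in_dim p j ->
  inner (e j) (S x) = lam j * inner (e j) x.
Proof.
by move=> pj; rewrite -S_sym; case: S_eig => _ -> // _; rewrite innerZl.
Qed.

Lemma eigen_le i j : (0 < i)%N -> (i <= j)%N -> in_dim p j -> lam j <= lam i.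
Proof.
by case: S_eig => _ _ h i0 ij pj; apply: h => //; exact: in_dim_le pj.
Qed.

(** Both operators are diagonal in the basis [e], so they commute coordinate by coordinate. *)
Lemma eigen_proj d x : in_dim p d.+1 ->
  S (proj_le e d x) = proj_le e d (S x).
Proof.
move=> pd; apply: (onb_ext _ e_onb) => j pj.
by rewrite eigen_inner// !(inner_proj e_onb pd _ _ pj) eigen_inner// mulrCA.
Qed.

(** Only the coordinates beyond [d] survive in the expansion of the quadratic form, and their
    eigenvalues are at most [lam d.+1]; the termwise comparison passes to the limit. *)
Lemma eigen_quad_tail d r : in_dim p d.+1 ->
  (forall j, (0 < j)%N -> (j <= d)%N -> inner (e j) r = 0) ->
  inner (S r) r <= lam d.+1 * `|r| ^+ 2.
Proof.
move=> pd r0.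
have h1 : (\sum_(1 <= j < N.+1 | in_dim p j) inner (e j) (S r) * inner (e j) r)
    @[N --> \oo] --> inner (S r) r by exact: onb_expand_inner.
have h2 : (lam d.+1 * \sum_(1 <= j < N.+1 | in_dim p j) inner (e j) r ^+ 2)
    @[N --> \oo] --> lam d.+1 * `|r| ^+ 2.
  by apply: cvgMr; exact: parseval_cvg.
apply: (ler_cvg_to h1 h2); apply: nearW => N.
rewrite mulr_sumr; apply: ler_sum => j pj; rewrite eigen_inner// -mulrA -expr2.
have [jd|dj] := leqP j d; first by rewrite r0 ?(in_dim_gt0 _ pj)// expr0n !mulr0.
by rewrite ler_wpM2r ?sqr_ge0// eigen_le.
Qed.

End Eigensystem.

(** * Perturbation of eigenvectors and eigenvalues *)

Section Perturbation.
Context {R : realType} {H : hilbertType R} {p : option nat}.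
Context {S S' : H -> H} {lam lam' : nat -> R} {e f : nat -> H} {d : nat}.
Hypotheses (S_sym : symmetric_op S) (S_eig : is_eigensystem p S lam e).
Hypotheses (S'_sym : symmetric_op S') (S'_eig : is_eigensystem p S' lam' f).
Hypothesis pd : in_dim p d.+1.

Let f_onb : is_onb p f. Proof. by case: S'_eig. Qed.
Let e_onb : is_onb p e. Proof. by case: S_eig. Qed.

(** Let [r] be the component of [e j] outside the span of [f 1, ..., f d]. The projection commutes
    with [S'], so the right-hand vector is [lam j *: r - S' r]. Its inner product with [r] is at
    least [(lam j - lam' d.+1) |r|^2], hence at least [delta |r|^2]; Cauchy-Schwarz then allows one
    factor [|r|] to be cancelled. *)
Lemma eigenvector_perturbation j delta : in_dim p j ->
  lam' d.+1 <= lam j - delta -> 0 <= delta ->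
  delta * `|e j - proj_le f d (e j)| <=
    `|S (e j) - S' (e j) - proj_le f d (S (e j) - S' (e j))|.
Proof.
move=> pj hlam delta0; set D := S (e j) - S' (e j).
set r := e j - proj_le f d (e j).
have rE : D - proj_le f d D = lam j *: r - S' r.
  have Q_sym := @proj_symmetric _ _ f d.
  rewrite /D /r (symmetric_opB Q_sym) (symmetric_opB S'_sym).
  case: S_eig => _ -> // _; rewrite (symmetric_opZ Q_sym) (eigen_proj S'_sym S'_eig)//.
  rewrite scalerBr !opprB -!addrA; congr (_ + _).
  by rewrite addrC -addrA [RHS]addrCA.
have S'r : inner (S' r) r <= lam' d.+1 * `|r| ^+ 2.
  apply: (eigen_quad_tail S'_sym S'_eig) => // i i0 id.
  exact: (proj_compl_orth f_onb pd).
have : delta * `|r| ^+ 2 <= `|D - proj_le f d D| * `|r|.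
  apply: le_trans (le_trans (ler_norm _) (ler_inner_norm _ _)).
  rewrite rE innerBl innerZl inner_norm.
  have : 0 <= (lam j - delta - lam' d.+1) * `|r| ^+ 2.
    by rewrite mulr_ge0 ?sqr_ge0 ?subr_ge0.
  by rewrite !mulrBl; lra.
have [->|r0] := eqVneq r 0; first by rewrite normr0 !mulr0.
by rewrite expr2 mulrA ler_pM2r// normr_gt0.
Qed.

(* A vector in the span of [f 1, ..., f d.+1] that is orthogonal to
   [e 1, ..., e d], which exists as there are only [d] linear constraints. *)
Lemma min_max_witness : exists2 v : H, v != 0 &
  (forall j, (0 < j)%N -> (j <= d)%N -> inner (e j) v = 0) /\
  lam' d.+1 * `|v| ^+ 2 <= inner (S' v) v.
Proof.
pose M : 'M[R]_(d.+1, d) := \matrix_(k, i) inner (e i.+1) (f k.+1).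
have : kermx M != 0.
  by rewrite kermx_eq0 -row_leq_rank -ltnNge (leq_ltn_trans (rank_leq_col _)).
case/rowV0Pn => c /sub_kermxP cM c0.
pose v := \sum_(k < d.+1) c 0 k *: f k.+1.
have pk (k : 'I_d.+1) : in_dim p k.+1.
  by apply: (in_dim_le p _ _ pd) => //; exact: ltn_ord.
have fv (k : 'I_d.+1) : inner (f k.+1) v = c 0 k.
  rewrite inner_sumr (bigD1 k)//= big1 ?addr0 => [|i ik].
    by rewrite innerZr f_onb.1// eqxx mulr1.
  rewrite innerZr f_onb.1//.
  by rewrite eqSS (inj_eq val_inj) eq_sym (negbTE ik) mulr0.
have vv : `|v| ^+ 2 = \sum_k c 0 k ^+ 2.
  rewrite -inner_norm {1}/v inner_suml; apply: eq_bigr => k _.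
  by rewrite innerZl fv.
exists v.
  apply: contra c0 => /eqP v0; apply/eqP/rowP => k.
  by rewrite -fv v0 inner0r mxE.
split => [j j0 jd|].
- case: j j0 jd => // j _ jd.
  rewrite inner_sumr.
  have := congr1 (fun A : 'rV_d => A 0 (Ordinal jd)) cM.
  rewrite !mxE => cMj; rewrite -[RHS]cMj.
  by apply: eq_bigr => k _; rewrite !mxE innerZr.
- rewrite vv mulr_sumr {2}/v inner_sumr; apply: ler_sum => k _.
  rewrite innerZr (innerC _ (f _)) (eigen_inner S'_sym S'_eig)// fv.
  rewrite [leRHS]mulrCA -expr2 ler_wpM2r ?sqr_ge0//.
  apply: (eigen_le S'_eig) => //; exact: ltn_ord.
Qed.

(** Both quadratic forms are compared at the min-max witness [v]: that of [S'] is at least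
    [lam' d.+1 * |v|^2], that of [S] at most [lam d.+1 * |v|^2]. *)
Lemma eigenvalue_perturbation m :
  (forall v, (forall j, (0 < j)%N -> (j <= d)%N -> inner (e j) v = 0) ->
     inner (S' v) v <= inner (S v) v + m * `|v| ^+ 2) ->
  lam' d.+1 <= lam d.+1 + m.
Proof.
move=> h; have [v v0 [ve vS']] := min_max_witness.
have h1 := le_trans vS' (h v ve).
have h2 := eigen_quad_tail S_sym S_eig _ _ pd ve.
have vp : 0 < `|v| ^+ 2 by rewrite exprn_gt0 ?normr_gt0.
by rewrite -(ler_pM2r vp) mulrDl; lra.
Qed.

End Perturbation.

(** * The excess risk *)

Section ExcessRisk.
Context {R : realType} {H : hilbertType R} {p : option nat}.
Context {S : H -> H} {lam : nat -> R} {e f : nat -> H} {d : nat}.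
Hypotheses (S_sym : symmetric_op S) (S_eig : is_eigensystem p S lam e).
Hypotheses (f_onb : is_onb p f) (pd : in_dim p d.+1).

Let e_onb : is_onb p e. Proof. by case: S_eig. Qed.
(** The squared length of the projection of [e j] onto the span of [f 1, ..., f d], so that
    [1 - b j] is the squared error of that projection. *)
Let b j := \sum_(1 <= k < d.+1) inner (f k) (e j) ^+ 2.

Let b_ge0 j : 0 <= b j.
Proof. by apply: sumr_ge0 => k _; exact: sqr_ge0. Qed.

Let bE j : in_dim p j -> `|e j - proj_le f d (e j)| ^+ 2 = 1 - b j.
Proof.
by move=> pj; rewrite (norm_proj_compl f_onb pd) -inner_norm e_onb.1// eqxx.
Qed.

Let b_le1 j : in_dim p j -> b j <= 1.
Proof. by move=> /bE h; rewrite -subr_ge0 -h sqr_ge0. Qed.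

Lemma sum_nat_truncate (F : nat -> R) (N : nat) : (d <= N)%N ->
  \sum_(1 <= j < N.+1 | in_dim p j) (j <= d)%:R * F j = \sum_(1 <= j < d.+1) F j.
Proof.
move=> dN; rewrite (big_cat_nat (n := d.+1))//=.
rewrite [X in _ + X]big_nat_cond [X in _ + X]big1 ?addr0 => [|j]; last first.
  by move=> /andP[/andP[dj _] _]; rewrite leqNgt dj mul0r.
rewrite big_nat_cond [RHS]big_nat_cond; apply: eq_big => j.
  by case: (boolP (1 <= j < d.+1)%N) => //= /(in_dim_nat pd).
by move=> /andP[/andP[_ jd] _]; rewrite -ltnS jd mul1r.
Qed.

(** This is the trace of the projection onto [f 1, ..., f d], computed in the basis [e]: after
    exchanging the sums, Parseval makes each [f k] contribute [1]. *)
Let cvg_sum_b :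
  (\sum_(1 <= j < N.+1 | in_dim p j) b j) @[N --> \oo] --> (d%:R : R).
Proof.
have h k : in_dim p k ->
    (\sum_(1 <= j < N.+1 | in_dim p j) inner (f k) (e j) ^+ 2) @[N --> \oo]
    --> (1 : R).
  move=> pk; have := parseval_cvg p e_onb (f k).
  rewrite -inner_norm f_onb.1// eqxx; apply: cvg_ext => N.
  by apply: eq_bigr => j _; rewrite innerC.
apply: (cvg_ext (f := fun N => \sum_(1 <= k < d.+1)
  \sum_(1 <= j < N.+1 | in_dim p j) inner (f k) (e j) ^+ 2)).
  by move=> N; rewrite exchange_big.
have -> : (d%:R : R) = \sum_(1 <= k < d.+1) 1.
  by rewrite sumr_const_nat subn1.
rewrite big_seq; under eq_cvg do rewrite big_seq.
apply: cvg_big => [|k]; first exact: add_continuous.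
by rewrite mem_index_iota => /(in_dim_nat pd) /h.
Qed.

(** The two projections have the same trace [d], so all eigenvalues may be shifted by a constant.
    The shift by [lam d.+1] makes every term nonnegative. The shift by [lp] makes the terms beyond
    [d] nonpositive, and dropping them gives the upper bound. *)
Lemma excess_risk_bounds lp : (forall j, in_dim p j -> 0 <= lam j) ->
  (forall j, in_dim p j -> lp <= lam j) ->
  0 <= excess_risk p e S f d <=
  \sum_(1 <= j < d.+1) (lam j - lp) * `|e j - proj_le f d (e j)| ^+ 2.
Proof.
move=> lam0 lamlp.
pose T N := \sum_(1 <= j < N.+1 | in_dim p j) lam j * ((j <= d)%:R - b j).
have TE : excess_risk p e S f d = limn T.
  rewrite /excess_risk /hs_inner; congr (limn _); apply/funext => N.
  apply: eq_bigr => j pj.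
  case: S_eig => _ -> // _; rewrite innerZl innerBr (inner_proj e_onb pd)//.
  rewrite e_onb.1// eqxx mulr1 (innerC _ (proj_le f d _)) inner_projl.
  by congr (_ * (_ - _)); apply: eq_bigr => k _; rewrite expr2.
(* The value of [limn] is informative only for a convergent sequence. The part with [j <= d] is
   eventually constant, and the sums of [lam j * b j] are nondecreasing and bounded by
   [lam 1 * d]. *)
have cT : cvgn T.
  pose C N := \sum_(1 <= j < N.+1 | in_dim p j) (j <= d)%:R * lam j.
  pose V N := \sum_(1 <= j < N.+1 | in_dim p j) lam j * b j.
  have -> : T = C - V.
    apply/funext => N; rewrite fctE -sumrB; apply: eq_bigr => j _.
    by rewrite mulrBr mulrC.
  apply: is_cvgB.
    apply: (@is_cvg_near_cst _ _ (\sum_(1 <= j < d.+1) lam j)).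
    by exists d => // N /= dN; rewrite /C sum_nat_truncate.
  apply: nondecreasing_is_cvgn.
    apply: nondecreasing_sum_nat => j pj; apply: mulr_ge0 => //; exact: lam0.
  exists (lam 1%N * d%:R) => _ [N _ <-].
  apply: (@le_trans _ _ (lam 1%N * \sum_(1 <= j < N.+1 | in_dim p j) b j)).
    rewrite mulr_sumr; apply: ler_sum => j pj; rewrite ler_wpM2r//.
    by apply: (eigen_le S_eig) => //; exact: in_dim_gt0 pj.
  have lam1 : 0 <= lam 1 by apply: lam0; exact: (in_dim_le p _ _ pd).
  rewrite ler_wpM2l//.
  rewrite -(cvg_lim _ cvg_sum_b)//.
  apply: (nondecreasing_cvgn_le _ _ N).
    by apply: nondecreasing_sum_nat.
  by apply/cvg_ex; exists d%:R.
(* The correction term carries the factor [d] minus the partial trace: it is nonnegative for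
   [m >= 0], and it vanishes in the limit. *)
have hB N m : (d <= N)%N -> T N =
    \sum_(1 <= j < N.+1 | in_dim p j) (lam j - m) * ((j <= d)%:R - b j) +
    m * (d%:R - \sum_(1 <= j < N.+1 | in_dim p j) b j).
  move=> dN; rewrite -[X in m * (X - _)](_ : 
    \sum_(1 <= j < N.+1 | in_dim p j) (j <= d)%:R * 1 = _); last first.
    by rewrite sum_nat_truncate// sumr_const_nat subn1.
  rewrite -sumrB mulr_sumr -big_split/=; apply: eq_bigr => j _; ring.
rewrite TE; apply/andP; split.
- apply: limr_ge => //; exists d => // N /= dN.
  rewrite (hB N (lam d.+1))// addr_ge0//.
    apply: sumr_ge0 => j pj; have [jd|dj] := leqP j d.
      rewrite mulr_ge0// ?subr_ge0 ?b_le1//.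
      by apply: (eigen_le S_eig) => //; [exact: in_dim_gt0 pj|exact: leqW].
    by rewrite mulr_le0// ?subr_le0 ?b_ge0//; apply: (eigen_le S_eig).
  rewrite mulr_ge0 ?lam0// subr_ge0 -(cvg_lim _ cvg_sum_b)//.
  apply: (nondecreasing_cvgn_le _ _ N).
    by apply: nondecreasing_sum_nat.
  by apply/cvg_ex; exists d%:R.
- set U := \sum_(1 <= j < d.+1) _.
  have c2 : (U + lp * (d%:R - \sum_(1 <= j < N.+1 | in_dim p j) b j))
      @[N --> \oo] --> U + lp * (d%:R - d%:R).
    apply: cvgD; first exact: cvg_cst.
    by apply: cvgMr; apply: cvgB; [exact: cvg_cst|exact: cvg_sum_b].
  rewrite subrr mulr0 addr0 in c2.
  apply: (ler_cvg_to cT c2); exists d => // N /= dN.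
  rewrite (hB N lp)// lerD2r /U -(sum_nat_truncate _ N dN); apply: ler_sum => j pj.
  rewrite bE// [leRHS]mulrCA ler_wpM2l ?subr_ge0 ?lamlp//.
  by have := b_ge0 j; case: (j <= d)%N => /=; rewrite ?mulr1n ?mulr0n; lra.
Qed.

End ExcessRisk.

(** * Borel measurability and operator norms *)

Section BorelMeasurability.
Context {R : realType} {H : hilbertType R}.

Lemma continuous_measurable_borel (f : H -> R) : continuous f ->
  measurable_fun [set: borel H] (f : borel H -> R).
Proof.
move=> /continuousP cf; apply: (measurability _ (RGenOpens.measurableE R)).
move=> _ [_ [a [b ->] <-]]; rewrite setTI.
by apply: sub_sigma_algebra; apply: cf; exact: interval_open.
Qed.

Lemma continuous_measurable_borel_map (f : H -> H) : continuous f ->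
  measurable_fun [set: borel H] (f : borel H -> borel H).
Proof.
move=> /continuousP cf.
apply: (@measurability _ _ (borel H) (borel H) setT f (@open H) erefl).
move=> _ [A oA <-]; rewrite setTI.
by apply: sub_sigma_algebra; exact: cf.
Qed.

Context {d : measure_display} {Om : measurableType d} {P : probability Om R}.

Lemma measurable_inner (X : {RV P >-> borel H}) (v : H) :
  measurable_fun setT (fun w => inner (X w : H) v).
Proof.
apply: (measurableT_comp (f := (fun x : H => inner x v) : borel H -> R)) => //.
exact: continuous_measurable_borel (continuous_innerl v).
Qed.

Lemma measurable_norm (X : {RV P >-> borel H}) :
  measurable_fun setT (fun w => `|X w : H|).
Proof.
apply: (measurableT_comp (f := (fun x : H => `|x|) : borel H -> R)) => //.
by apply: continuous_measurable_borel; exact: norm_continuous.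
Qed.

(** An injection of [D] into the natural numbers turns the union into a sequence of unions, each
    over at most one index. *)
Lemma countable_bigcup_measurable {T : Type} (D : set T) (F : T -> set Om) :
  countable D -> (forall x, D x -> measurable (F x)) ->
  measurable (\bigcup_(x in D) F x).
Proof.
move=> /countable_injP[g ginj] mF.
have -> : \bigcup_(x in D) F x =
    \bigcup_n \bigcup_(x in D `&` [set x | g x = n]) F x.
  apply/seteqP; split => [w [x Dx Fxw]|w [n _ [x [Dx _] Fxw]]].
    by exists (g x) => //; exists x.
  by exists x.
apply: bigcupT_measurable => n.
have [[x [Dx gx]]|nx] := pselect (exists x, D x /\ g x = n); last first.
  rewrite (_ : \bigcup_(_ in _) _ = set0) ?measurable0//.
  by apply/seteqP; split => // w [x [Dx gx] _]; apply: nx; exists x.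
rewrite (_ : \bigcup_(_ in _) _ = F x); first exact: mF.
apply/seteqP; split => [w [y [Dy gy]]|w Fxw]; last by exists x.
by rewrite (ginj x y) ?inE// gx.
Qed.

End BorelMeasurability.

Section OperatorNorm.
Context {R : realType} {H : hilbertType R}.

Lemma opnorm_ub (T : H -> H) x : `|x| <= 1 -> (`|T x|%:E <= opnorm T)%E.
Proof. by move=> x1; apply: ereal_sup_ubound; exists x. Qed.

Lemma le_opnorm (T : H -> H) (c : R) :
  (forall a x, T (a *: x) = a *: T x) -> 0 <= c -> (opnorm T <= c%:E)%E ->
  forall x, `|T x| <= c * `|x|.
Proof.
move=> TZ c0 Tc x.
have [->|x0] := eqVneq x 0.
  by rewrite -[in T _](scale0r 0) TZ scale0r !normr0 mulr0.
have nx : 0 < `|x| by rewrite normr_gt0.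
have : `|(`|x|^-1 *: x)| <= 1 by rewrite normrZ normfV normr_id mulVf ?gt_eqF.
move=> /(opnorm_ub T) /le_trans /(_ Tc).
by rewrite lee_fin TZ normrZ normfV normr_id ler_pdivrMl// mulrC.
Qed.

Context {d : measure_display} {Om : measurableType d}.
Context {p : option nat} {e : nat -> H}.

Lemma measurable_norm_coords (Y : Om -> H) : is_onb p e ->
  (forall j, in_dim p j -> measurable_fun setT (fun w => inner (e j) (Y w))) ->
  measurable_fun setT (fun w => `|Y w|).
Proof.
move=> e_onb mY.
have m2 : measurable_fun setT (fun w => `|Y w| ^+ 2).
  apply: (@measurable_fun_cvg _ _ _ setT (fun N w =>
    \sum_(1 <= j < N.+1 | in_dim p j) inner (e j) (Y w) ^+ 2)); last first.
    by move=> w _; exact: parseval_cvg.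
  move=> N; under eq_fun do rewrite big_mkcond.
  apply: measurable_sum => j; case: (boolP (in_dim p j)) => [pj|_].
    by apply: measurable_funX; exact: mY.
  exact: measurable_cst.
rewrite (_ : (fun w => `|Y w|) = (fun w => Num.sqrt (`|Y w| ^+ 2))).
  apply: (measurableT_comp (f := @Num.sqrt R)) => //.
  by apply: continuous_measurable_fun; exact: sqrt_continuous.
by apply/funext => w; rewrite sqrtr_sqr normr_id.
Qed.

(* By homogeneity and continuity, the supremum defining the norm can be taken
   over the points of a countable dense set lying in the unit ball. *)
Lemma measurable_opnorm_gt (A : Om -> H -> H) (c : R) :
  separable H -> is_onb p e -> 0 <= c ->
  (forall w a x, A w (a *: x) = a *: A w x) ->
  (forall w, exists M, forall x y, `|A w x - A w y| <= M * `|x - y|) ->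
  (forall j y, in_dim p j -> measurable_fun setT (fun w => inner (e j) (A w y))) ->
  measurable [set w | (c%:E < opnorm (A w))%E].
Proof.
move=> [D cD dD] e_onb c0 AZ Alip mA.
have -> : [set w | (c%:E < opnorm (A w))%E] =
    \bigcup_(y in D `&` [set y | `|y| <= 1]) [set w | c < `|A w y|].
  apply/seteqP; split => [w /= /ereal_sup_gt[_ [x /= x1 <-]]|w [y [_ y1] /= cy]].
    rewrite lte_fin => cx.
    have Ax0 : 0 < `|A w x| by exact: le_lt_trans cx.
    (* Halfway between [c / |A w x|] and [1]: scaling [x] by [r] moves it strictly inside the unit
       ball while the norm of its image still exceeds [c]. *)
    pose r := (c / `|A w x| + 1) / 2.
    have cAx : c / `|A w x| < 1 by rewrite ltr_pdivrMr// mul1r.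
    have cAx0 : 0 <= c / `|A w x| by rewrite divr_ge0// ltW.
    have r1 : r < 1 by rewrite /r; lra.
    have r0 : 0 < r by rewrite /r; lra.
    have rc : c < `|A w (r *: x)|.
      rewrite AZ normrZ gtr0_norm// -ltr_pdivrMr// /r; lra.
    have [M hM] := Alip w.
    pose M' := Num.max M 1.
    have M'0 : 0 < M' by rewrite lt_max ltr01 orbT.
    (* The first bound keeps the approximating point in the unit ball, the second keeps the norm of
       its image above [c]. *)
    pose del := Num.min (1 - r) ((`|A w (r *: x)| - c) / M').
    have del0 : 0 < del by rewrite lt_min subr_gt0 r1/= divr_gt0// subr_gt0.
    have [y [By Dy]] : (ball (r *: x) del `&` D) !=set0.
      apply: dD; last exact: ball_open.
      by exists (r *: x); exact: ballxx.
    move: By; rewrite -ball_normE/= => By.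
    exists y; [split => //=|] => /=.
      have : `|y| <= `|r *: x| + `|r *: x - y|.
        by rewrite -{1}(subKr (r *: x) y) ler_normB.
      move=> /le_trans; apply.
      have : `|r *: x| <= r by rewrite normrZ gtr0_norm// ler_piMr// ltW.
      have : `|r *: x - y| < 1 - r by rewrite (lt_le_trans By)// ge_min lexx.
      lra.
    have h1 : `|A w (r *: x)| <= `|A w y| + `|A w (r *: x) - A w y|.
      by rewrite -{1}(subrKC (A w y) (A w (r *: x))) ler_normD.
    have h2 : `|A w (r *: x) - A w y| < `|A w (r *: x)| - c.
      apply: le_lt_trans (hM _ _) _.
      apply: (@le_lt_trans _ _ (M' * `|r *: x - y|)).
        by rewrite ler_wpM2r// le_max lexx.
      rewrite mulrC -ltr_pdivlMr//; apply: lt_le_trans By _.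
      by rewrite ge_min lexx orbT.
    lra.
  by apply: lt_le_trans (opnorm_ub _ _ y1); rewrite lte_fin.
apply: countable_bigcup_measurable.
  by apply: sub_countable cD; apply: subset_card_le; exact: subIsetl.
move=> y _.
rewrite (_ : [set w | _] = (fun w => `|A w y|) @^-1` `]c, +oo[%classic).
  have mN : measurable_fun setT (fun w => `|A w y|).
    by apply: (measurable_norm_coords _ e_onb) => j; exact: mA.
  by rewrite -[X in measurable X]setTI; apply: mN => //; exact: measurable_itv.
by apply/seteqP; split => w /=; rewrite in_itv/= andbT.
Qed.

End OperatorNorm.

Section BoundedOperators.
Context {R : realType} {H : hilbertType R}.

Lemma symmetric_bounded_continuous (T : H -> H) (M : R) : symmetric_op T ->
  (forall x, `|T x| <= M * `|x|) -> continuous T.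
Proof.
move=> T_sym TM x; apply/cvgrPdist_le => e e0.
pose M' := Num.max M 1.
have M'0 : 0 < M' by rewrite lt_max ltr01 orbT.
have /cvgrPdist_le xx : y @[y --> x] --> x by exact: cvg_id.
have := xx _ (divr_gt0 e0 M'0).
apply: filterS => y; rewrite ler_pdivlMr// => xy.
rewrite -(symmetric_opB T_sym); apply: le_trans (TM _) _.
apply: le_trans xy; rewrite mulrC ler_wpM2l//.
by rewrite le_max lexx.
Qed.

Context {p : option nat} {S : H -> H} {lam : nat -> R} {e : nat -> H}.

Lemma eigen_bounded : symmetric_op S -> is_eigensystem p S lam e ->
  (forall j, in_dim p j -> 0 <= lam j) -> in_dim p 1 ->
  forall x, `|S x| <= lam 1 * `|x|.
Proof.
move=> S_sym S_eig lam0 p1 x.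
have e_onb : is_onb p e by case: S_eig.
rewrite -(@ler_pXn2r _ 2)// ?nnegrE ?mulr_ge0 ?lam0// exprMn.
have h1 := parseval_cvg p e_onb (S x).
have h2 : (lam 1 ^+ 2 * \sum_(1 <= j < N.+1 | in_dim p j) inner (e j) x ^+ 2)
    @[N --> \oo] --> lam 1 ^+ 2 * `|x| ^+ 2.
  by apply: cvgMr; exact: parseval_cvg.
apply: (ler_cvg_to h1 h2); apply: nearW => N.
rewrite mulr_sumr; apply: ler_sum => j pj.
rewrite (eigen_inner S_sym S_eig)// exprMn ler_wpM2r ?sqr_ge0//.
rewrite ler_pXn2r ?nnegrE ?lam0//; apply: (eigen_le S_eig) => //.
exact: in_dim_gt0 pj.
Qed.

End BoundedOperators.

(** * Covariance operators and their empirical versions *)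

Section Covariance.
Context {R : realType} {H : hilbertType R}.
Context {dOm : measure_display} {Om : measurableType dOm} {P : probability Om R}.

Lemma covariance_inner (X : Om -> H) (S : H -> H) x y : is_covariance P X S ->
  ((inner (S x) y)%:E = 'E_P[fun w => (inner (X w) x * inner (X w) y)%R])%E.
Proof.
move=> /(_ x y) ->; congr ('E_P[_])%E; apply/funext => w.
by rewrite /tensor innerZl.
Qed.

Lemma covariance_symmetric (X : Om -> H) (S : H -> H) :
  is_covariance P X S -> symmetric_op S.
Proof.
move=> XS x y; apply: EFin_inj; rewrite (innerC x) !(covariance_inner _ _ _ _ XS).
by congr ('E_P[_])%E; apply/funext => w; rewrite mulrC.
Qed.

Context {n : nat} (Xs : 'I_n -> {RV P >-> borel H}).

Lemma emp_cov_inner w x y : inner (emp_cov Xs w x) y =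
  n%:R^-1 * \sum_(i < n) inner (Xs i w : H) x * inner (Xs i w : H) y.
Proof.
rewrite /emp_cov innerZl inner_suml; congr (_ * _).
by apply: eq_bigr => i _; rewrite /tensor innerZl.
Qed.

Lemma emp_cov_symmetric w : symmetric_op (emp_cov Xs w).
Proof.
move=> x y; rewrite (innerC x) !emp_cov_inner; congr (_ * _).
by apply: eq_bigr => i _; rewrite mulrC.
Qed.

Lemma emp_cov_bounded w x :
  `|emp_cov Xs w x| <= (n%:R^-1 * \sum_(i < n) `|Xs i w : H| ^+ 2) * `|x|.
Proof.
rewrite /emp_cov normrZ ger0_norm ?invr_ge0// -mulrA ler_wpM2l ?invr_ge0//.
rewrite mulr_suml (le_trans (ler_norm_sum _ _ _))//; apply: ler_sum => i _.
rewrite /tensor normrZ expr2 -mulrA mulrC ler_wpM2l//.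
exact: ler_inner_norm.
Qed.

Lemma measurable_emp_cov x y :
  measurable_fun setT (fun w => inner (emp_cov Xs w x) y).
Proof.
under eq_fun do rewrite emp_cov_inner.
apply: measurable_funM; first exact: measurable_cst.
by apply: measurable_sum => i; apply: measurable_funM; exact: measurable_inner.
Qed.

Lemma measurable_cov_diff (S : H -> H) x y :
  measurable_fun setT (fun w => inner ((S \- emp_cov Xs w) x) y).
Proof.
rewrite /=; under eq_fun do rewrite innerBl.
by apply: measurable_funB; [exact: measurable_cst|exact: measurable_emp_cov].
Qed.

Lemma cov_diff_symmetric (S : H -> H) w : symmetric_op S ->
  symmetric_op (S \- emp_cov Xs w).
Proof.
by move=> S_sym x y /=; rewrite innerBl innerBr S_sym emp_cov_symmetric.
Qed.

Definition comp_rv {T : H -> H} (cT : continuous T) (X : {RV P >-> borel H}) :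
    {RV P >-> borel H} :=
  HB.pack ((fun w => T (X w)) : Om -> borel H)
    (isMeasurableFun.Build _ _ Om (borel H) (fun w => T (X w))
      (measurableT_comp (continuous_measurable_borel_map _ cT)
        (@measurable_funPT _ _ _ _ X))).

End Covariance.

(** * Fourth moments from exponential tails *)

Section TailMoment.
Context {R : realType} {dOm : measure_display} {Om : measurableType dOm}.
Context (P : probability Om R).

(** The fifth power of [1 + t / 5 <= exp (t / 5)]. Exponent five beats the fourth moment by one
    factor, which is what makes the dyadic sum below converge. *)
Lemma expR_ge_exp5 (t : R) : 0 <= t -> (t / 5) ^+ 5 <= expR t.
Proof.
move=> t0; have {2}-> : t = 5%:R * (t / 5) by field.
rewrite expRM_natl ler_pXn2r ?nnegrE ?divr_ge0 ?expR_ge0//.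
by apply: le_trans (expR_ge1Dx _); lra.
Qed.

Lemma dyadic_level (x : R) : 2 < x ->
  exists i : nat, 2 ^+ i.+1 < x <= 2 ^+ i.+2.
Proof.
move=> x2.
have ex : exists i : nat, x <= 2 ^+ i.+1.
  exists (Num.truncn x); apply: (@le_trans _ _ (Num.truncn x).+1%:R).
    exact/ltW/truncnS_gt.
  by rewrite -natrX ler_nat ltnW// ltn_expl.
case: (ex_minnP ex) => -[|i xi imin]; first by rewrite expr1 leNgt x2.
exists i; rewrite xi andbT ltNge; apply/negP => /imin.
by rewrite ltnn.
Qed.

(** The values [W <= 2] contribute at most [16]. On the dyadic level where [W] lies between
    [2 ^ i.+1] and [2 ^ i.+2], the fourth power is at most [16 ^ i.+2]; multiplied by the tail
    probability this is at most [16 * 5 ^ 5 / 2 ^ i.+1], and these bounds sum to [16 * 5 ^ 5]. *)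
Lemma tail_moment4 (W : Om -> R) : measurable_fun setT W ->
  (forall w, 0 <= W w) ->
  (forall m : R, 2 <= m -> (P [set w | m < W w]%R <= (expR (- m))%:E)%E) ->
  (\int[P]_w (W w ^+ 4)%:E <= (16 + 16 * 5 ^+ 5)%:E)%E.
Proof.
move=> mW W0 tailW.
have mT m : measurable [set w | m < W w].
  rewrite (_ : [set w | _] = W @^-1` `]m, +oo[%classic).
    by rewrite -[X in measurable X]setTI; apply: mW => //; exact: measurable_itv.
  by apply/seteqP; split => w /=; rewrite in_itv/= andbT.
pose c i : R := 16 ^+ i.+2.
pose A i := [set w | 2 ^+ i.+1 < W w].
pose F i w := ((c i)%:E * (\1_(A i) w)%:E)%E.
have F0 i w : (0 <= F i w)%E.
  by rewrite /F -EFinM lee_fin mulr_ge0 ?exprn_ge0.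
have mF i : measurable_fun setT (F i).
  apply: measurable_funeM; apply/measurable_EFinP.
  exact/measurable_indicP/mT.
apply: (@le_trans _ _ (\int[P]_w (16%:E + \sum_(i <oo) F i w))%E).
  apply: ge0_le_integral => //=.
  - by move=> w _; rewrite lee_fin exprn_ge0.
  - by apply/measurable_EFinP; exact: measurable_funX.
  - apply: emeasurable_funD; first exact: measurable_cst.
    by apply: ge0_emeasurable_sum => // k w _ _.
  - move=> w _; have [W2|W2] := leP (W w) 2.
      rewrite -[leLHS]adde0 leeD//; last exact: nneseries_ge0.
      rewrite lee_fin (_ : 16 = 2 ^+ 4); last by ring.
      by rewrite ler_pXn2r ?nnegrE.
    have [i /andP[iW Wi]] := dyadic_level _ W2.
    rewrite -[leLHS]add0e leeD// ?lee_fin//.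
    apply: (@le_trans _ _ (F i w)).
      rewrite /F indicE mem_set//= mule1 lee_fin /c.
      rewrite (_ : 16 = 2 ^+ 4); last by ring.
      by rewrite -exprM mulnC exprM ler_pXn2r ?nnegrE// exprn_ge0.
    rewrite (@nneseriesD1 _ _ i)//= leeDl//.
    exact: nneseries_ge0.
rewrite ge0_integralD//; last 2 first.
- by move=> w _; exact: nneseries_ge0.
- by apply: ge0_emeasurable_sum => // k w _ _.
rewrite integral_cst//= [P _]probability_setT. rewrite mule1 integral_nneseries//.
rewrite [leRHS]EFinD leeD2l//.
have K0 : 0 <= 16 * 5 ^+ 5 :> R by rewrite mulr_ge0 ?exprn_ge0.
apply: le_trans (epsilon_trick0 xpredT K0).
apply: lee_nneseries => [i _ _|i _].
  by apply: integral_ge0 => w _; exact: F0.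
rewrite ge0_integralZl_EFin//; last 2 first.
- by apply/measurable_EFinP; exact/measurable_indicP/mT.
- by rewrite exprn_ge0.
rewrite integral_indic//; last exact: mT.
rewrite setIT.
apply: (@le_trans _ _ ((c i)%:E * (expR (- 2 ^+ i.+1))%:E)%E).
  rewrite lee_wpmul2l ?lee_fin ?exprn_ge0//; apply: tailW.
  by rewrite exprS ler_peMr// exprn_ege1// ler1n.
rewrite -EFinM lee_fin.
set x := 2 ^+ i.+1.
have x0 : 0 < x by rewrite exprn_gt0.
have := expR_ge_exp5 x (ltW x0).
rewrite expRN natrX -/x.
have -> : c i = 16 * x ^+ 4.
  by rewrite /c exprS -exprM mulnC exprM (_ : 16 = 2 ^+ 4)//; ring.
move=> h; rewrite ler_pdivrMr ?expR_gt0//.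
apply: (@le_trans _ _ (16 * 5 ^+ 5 / x * (x / 5) ^+ 5)); last first.
  by rewrite ler_wpM2l// divr_ge0// ltW.
rewrite le_eqVlt; apply/orP; left; apply/eqP; field.
by rewrite gt_eqF.
Qed.
End TailMoment.

(** * Series over the index set, and diagonal operators *)

Section SeriesInDim.
Context {R : realType} (p : option nat).
Local Open Scope ereal_scope.

(** A common normal form for sums with different starting indices: series from [0] with zeros at the
    excluded indices, which can be compared term by term. *)
Lemma eseries_in_dim (f : nat -> \bar R) (r : nat) :
  \sum_(r.+1 <= j <oo | in_dim p j) f j =
  \sum_(j <oo) (if in_dim p j && (r < j)%N then f j else 0).
Proof. by rewrite eseries_cond [RHS]eseries_mkcond; exact: eseries_mkcond. Qed.

Lemma eseries_in_dim_gt (f : nat -> \bar R) (r : nat) :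
  \sum_(1 <= j <oo | in_dim p j) (if (r < j)%N then f j else 0) =
  \sum_(r.+1 <= j <oo | in_dim p j) f j.
Proof.
rewrite !eseries_in_dim; apply: eq_eseriesr => j _.
by case: (boolP (in_dim p j)) => //= /in_dim_gt0 ->.
Qed.

Lemma eseries_in_dim_finite (f : nat -> \bar R) (m : nat) :
  (forall j, (m < j)%N -> f j = 0) ->
  \sum_(1 <= j <oo | in_dim p j) f j = \sum_(1 <= j < m.+1 | in_dim p j) f j.
Proof.
move=> f0; apply: lim_near_cst => //; exists m.+1 => // N /= mN.
rewrite (@big_cat_nat _ _ _ m.+1)//= [X in _ + X]big_nat_cond.
by rewrite [X in _ + X]big1 ?adde0// => j /andP[/andP[mj _] _]; exact: f0.
Qed.

End SeriesInDim.

Lemma sum1_count_pred (I : eqType) (r : seq I) (a : pred I) :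
  (\sum_(i <- r) a i = count a r)%N.
Proof. by rewrite -sum1_count [RHS]big_mkcond; apply: eq_bigr => i _; case: (a i). Qed.

Section DiagonalOperator.
Context {R : realType} {H : hilbertType R} {p : option nat} {u : nat -> H}.
Hypothesis u_onb : is_onb p u.
Context (t : nat -> R) {m : nat}.
Hypothesis pm : in_dim p m.

(** Cutting off at [m] gives finite rank, so the operator is bounded for every choice of [t]. *)
Definition diag_op (x : H) : H :=
  \sum_(1 <= j < m.+1) (t j * inner (u j) x) *: u j.

Lemma diag_op_symmetric : symmetric_op diag_op.
Proof.
move=> x y; rewrite /diag_op inner_suml inner_sumr; apply: eq_bigr => j _.
by rewrite innerZl innerZr (innerC x); ring.
Qed.

Lemma diag_op_basis j : in_dim p j ->
  diag_op (u j) = ((j <= m)%:R * t j) *: u j.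
Proof.
move=> pj; rewrite /diag_op -(big_nat_in_dim p _ _ _ pm).
have [jm|mj] := leqP j m.
  rewrite big_mkcond (bigD1_seq j) ?iota_uniq ?mem_index_iota ?(in_dim_gt0 _ pj)//=.
  rewrite pj u_onb.1// eqxx mulr1 mul1r big1 ?addr0// => i ij.
  case: ifPn => // pi; rewrite u_onb.1// (negbTE ij) mulr0 scale0r//.
rewrite mul0r scale0r big_nat_cond big1// => i /andP[/andP[_ im] pi].
rewrite u_onb.1// ltn_eqF ?mulr0 ?scale0r//; exact: leq_trans mj.
Qed.

Lemma diag_op_bounded x : `|diag_op x| <= (\sum_(1 <= j < m.+1) `|t j|) * `|x|.
Proof.
rewrite /diag_op mulr_suml (le_trans (ler_norm_sum _ _ _))//.
rewrite -!(big_nat_in_dim p _ _ _ pm); apply: ler_sum => j pj.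
have uj : `|u j| = 1.
  apply/eqP; rewrite -(@eqrXn2 _ 2)// expr1n -inner_norm u_onb.1// eqxx//.
rewrite normrZ uj mulr1 normrM ler_wpM2l//.
by rewrite (le_trans (ler_inner_norm _ _))// uj mul1r.
Qed.

End DiagonalOperator.

(** * Concentration and expectation bounds *)

Section Concentration.
Context {R : realType} {C1 C3 : R}.
Hypotheses (C3_gt1 : 1 < C3) (hconc : is_concentration_constant C1 C3).
Context {H : hilbertType R} {p : option nat}.
Context {dOm : measure_display} {Om : measurableType dOm} {P : probability Om R}.
Context {X : {RV P >-> borel H}} {S : H -> H} {lam : nat -> R} {u : nat -> H}.
Context {n : nat} {Xs : 'I_n -> {RV P >-> borel H}}.
Hypotheses (H_sep : separable H) (X_mean : is_mean P X 0).
Hypotheses (X_cov : is_covariance P X S) (S_eig : is_eigensystem p S lam u).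
Hypotheses (X_sg : sub_gaussian P C1 X) (n_gt0 : (1 <= n)%N).
Hypothesis Xs_iid : iid_copies X Xs.
Hypothesis lam_gt0 : forall j, in_dim p j -> 0 < lam j.

Let u_onb : is_onb p u. Proof. by case: S_eig. Qed.
Let S_sym : symmetric_op S. Proof. exact: covariance_symmetric X_cov. Qed.
Let nR : 0 < n%:R :> R. Proof. by rewrite ltr0n. Qed.
Let C3_gt0 : 0 < C3. Proof. exact: lt_trans C3_gt1. Qed.
Let lam_ge0 j : in_dim p j -> 0 <= lam j. Proof. by move=> /lam_gt0/ltW. Qed.

Let Delta w := (S \- emp_cov Xs w).
(* The concentration inequality applied to the linear image [T X], which is
   again sub-Gaussian with the same constant. *)
Lemma concentration_image {T : H -> H} {t : nat -> R} {M : R} {i0 : nat} {x : R} :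
  symmetric_op T -> (forall v, `|T v| <= M * `|v|) ->
  (forall j, in_dim p j -> T (u j) = t j *: u j) -> in_dim p i0 ->
  (forall j, in_dim p j -> t j ^+ 2 * lam j <= t i0 ^+ 2 * lam i0) ->
  0 < x ->
  (\sum_(1 <= j <oo | in_dim p j) (t j ^+ 2 * lam j)%:E <=
     (n%:R * (t i0 ^+ 2 * lam i0) * Num.min x (x ^+ 2))%:E)%E ->
  (P [set w | (C3 * (t i0 ^+ 2 * lam i0) * x)%:E <
       opnorm (fun v => T ((S \- emp_cov Xs w)%R (T v)))]
     <= (expR (- (n%:R * Num.min x (x ^+ 2))))%:E)%E.
Proof.
move=> T_sym TM Tu pi0 i0_max x0 trx.
have cT := symmetric_bounded_continuous _ _ T_sym TM.
(* The covariance of [T X] is [T S T], which is diagonal in the basis [u] with eigenvalues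
   [t j ^+ 2 * lam j]. *)
have cov_coord v j : in_dim p j ->
    inner (u j) (T (S (T v))) = t j ^+ 2 * lam j * inner (u j) v.
  move=> pj; rewrite -T_sym Tu// innerZl (eigen_inner S_sym S_eig)// -T_sym Tu//.
  by rewrite innerZl; ring.
have TX v w : inner (T (X w : H)) v = inner (X w : H) (T v) by rewrite T_sym.
have := hconc H H_sep p u u_onb dOm Om P (comp_rv cT X) (fun v => T (S (T v)))
  (t i0 ^+ 2 * lam i0).
set a := (C3 * _ * x)%:E.
(* Conjugation by [T] commutes with forming the sample covariance, so the event is the one of the
   hypothesis for the variables [T X_i]. *)
have -> : [set w | (a < opnorm (fun v => T ((S \- emp_cov Xs w)%R (T v))))%E] =
   [set w | (a < opnorm ((fun v => T (S (T v))) \-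
     emp_cov (fun i => comp_rv cT (Xs i)) w)%R)%E].
  apply/funext => w /=; congr (_ < opnorm _)%E; apply/funext => v /=.
  rewrite (symmetric_opB T_sym); congr (_ - _).
  rewrite /emp_cov (symmetric_opZ T_sym) (symmetric_op_sum T_sym).
  congr (_ *: _); apply: eq_bigr => i _.
  by rewrite /tensor (symmetric_opZ T_sym) -T_sym.
apply => //.
- move=> v; rewrite inner0l; have := X_mean (T v); rewrite inner0l => ->.
  by congr ('E_P[_])%E; apply/funext => w; rewrite -TX.
- split.
    rewrite /sq_integrable; apply: (@le_lt_trans _ _
      ((M ^+ 2)%:E * 'E_P[fun w => (`|X w : H| ^+ 2)%R])%E).
      rewrite unlock -ge0_integralZl_EFin//=.
      + apply: ge0_le_integral => //=.
        * apply/measurable_EFinP; apply: measurable_funX.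
          exact: (measurable_norm (comp_rv cT X)).
        * apply: measurable_funeM; apply/measurable_EFinP.
          by apply: measurable_funX; exact: measurable_norm.
        * move=> w _; rewrite -EFinM lee_fin -exprMn ler_pXn2r ?nnegrE//.
          exact: le_trans (TM _).
      + apply/measurable_EFinP.
        by apply: measurable_funX; exact: measurable_norm.
      + exact: sqr_ge0.
    rewrite lte_mul_pinfty//; last by case: X_sg.
    by rewrite lee_fin sqr_ge0.
  move=> v; have := X_sg.2 (T v).
  congr (_ <= _)%E.
    congr ereal_sup; apply: eq_imagel => k _; congr (_ * (_ `^ _))%E.
    by congr ('E_P[_])%E; apply/funext => w; rewrite -TX.
  by congr (_ * (_ `^ _))%E; congr ('E_P[_])%E; apply/funext => w; rewrite -TX.
- move=> y v; rewrite T_sym; have := X_cov (T y) (T v) => ->.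
  congr ('E_P[_])%E; apply/funext => w.
  by rewrite /tensor !innerZl -!TX.
- split.
    exists (u i0).
      rewrite -normr_eq0 -sqrf_eq0 -inner_norm u_onb.1// eqxx.
      by rewrite oner_eq0.
    apply: (onb_ext _ u_onb) => j pj; rewrite cov_coord// innerZr.
    rewrite u_onb.1//; case: eqVneq => [->//|_]; by rewrite !mulr0.
  (* An eigenvector has a nonzero coordinate along some [u j], which identifies its eigenvalue with
     [t j ^+ 2 * lam j]. *)
  move=> m [v v0 Tv].
  have [j [pj jv]] : exists j, in_dim p j /\ inner (u j) v != 0.
    apply: contrapT => h; move/eqP: v0; apply; apply: (onb_ext _ u_onb) => j pj.
    rewrite inner0r; apply/eqP/negPn/negP => jv; apply: h; by exists j.
  have := cov_coord v j pj; rewrite Tv innerZr => /(mulIf jv) ->.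
  exact: i0_max.
- case: Xs_iid => Xind Xdist; split.
    move=> J A mA.
    have := Xind J (fun i => T @^-1` A i); apply => i iJ.
    rewrite -[X in measurable X]setTI.
    by apply: (continuous_measurable_borel_map _ cT) => //; exact: mA.
  move=> i A mA; have := Xdist i (T @^-1` A); apply.
  rewrite -[X in measurable X]setTI.
  exact: (continuous_measurable_borel_map _ cT).
- rewrite /trace; apply: le_trans trx; rewrite le_eqVlt; apply/orP; left.
  apply/eqP; apply: eq_eseriesr => j pj; congr EFin.
  by rewrite cov_coord// u_onb.1// eqxx mulr1.
Qed.

Lemma measurable_cov_diff_opnorm {T : H -> H} {M : R} {c : R} :
  symmetric_op T -> (forall v, `|T v| <= M * `|v|) ->
  (forall j, in_dim p j -> 0 <= lam j) -> in_dim p 1 -> 0 <= c ->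
  measurable [set w | (c%:E < opnorm (fun v => T ((S \- emp_cov Xs w)%R (T v))))%E].
Proof.
move=> T_sym TM lam0 p1 c0.
have SM := eigen_bounded S_sym S_eig lam0 p1.
apply: (measurable_opnorm_gt _ _ H_sep u_onb) => //.
- move=> w a x; rewrite (symmetric_opZ T_sym).
  by rewrite (symmetric_opZ (cov_diff_symmetric Xs _ w S_sym)) (symmetric_opZ T_sym).
- move=> w; set E := (n%:R^-1 * \sum_(i < n) `|Xs i w : H| ^+ 2).
  (* The Lipschitz constant may depend on the sample: [S] has norm at most [lam 1], the empirical
     covariance at most [E]. *)
  exists (`|M| * ((lam 1%N + E) * `|M|)) => x y.
  rewrite -(symmetric_opB T_sym) -(symmetric_opB (cov_diff_symmetric Xs _ w S_sym)).
  rewrite -(symmetric_opB T_sym); move: (x - y) => z.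
  have TM' v : `|T v| <= `|M| * `|v|.
    by apply: le_trans (TM _) _; rewrite ler_wpM2r// ler_norm.
  apply: le_trans (TM' _) _; rewrite -!mulrA ler_wpM2l//.
  have E0 : 0 <= lam 1%N + E.
    rewrite addr_ge0 ?lam0// mulr_ge0 ?invr_ge0//.
    by apply: sumr_ge0 => i _; rewrite sqr_ge0.
  apply: (@le_trans _ _ ((lam 1%N + E) * `|T z|)); last by rewrite ler_wpM2l.
  rewrite mulrDl (le_trans (ler_normB _ _))// lerD// ?SM//.
  exact: emp_cov_bounded.
- move=> j y pj; under eq_fun do rewrite -T_sym innerC.
  exact: measurable_cov_diff.
Qed.

(** The first factor is the bound of [tail_moment4]; [C3 ^+ 4] undoes the division by [C3] in the
    normalised entry to which that bound is applied. *)
Definition moment_constant := (16 + 16 * 5 ^+ 5) * C3 ^+ 4.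

Lemma moment_constant_ge1 : 1 <= moment_constant.
Proof.
have h : 1 <= C3 ^+ 4 by rewrite exprn_ege1// ltW.
have h5 : 0 <= 16 * 5 ^+ 5 :> R by rewrite mulr_ge0// exprn_ge0.
rewrite /moment_constant; apply: (@le_trans _ _ (16 * C3 ^+ 4)); first by lra.
by rewrite ler_wpM2r// ?lerDl//; lra.
Qed.

(* Standardising the coordinates [j] and [k] of [X] gives an image with largest
   covariance eigenvalue [1] and trace at most [2], so the concentration inequality
   at [x = y / sqrt n] yields the tail [exp (- y)] for all [y >= 2]. *)
Lemma cov_entry_moment4 j k : in_dim p j -> in_dim p k ->
  (\int[P]_w (inner (Delta w (u j)) (u k) ^+ 4)%:E <=
     (moment_constant * (lam j * lam k / n%:R) ^+ 2)%:E)%E.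
Proof.
move=> pj pk.
pose t i := if (i == j) || (i == k) then (Num.sqrt (lam i))^-1 else 0.
pose m := maxn j k.
have pm : in_dim p m by rewrite /m; case: (leqP j k) => // _.
have t2 i : in_dim p i -> t i ^+ 2 * lam i = ((i == j) || (i == k))%:R.
  move=> pi; rewrite /t; case: ifP => _; last by rewrite expr0n mul0r.
  by rewrite exprVn sqr_sqrtr ?lam_ge0// mulVf// gt_eqF// lam_gt0.
have tj : 0 < t j by rewrite /t eqxx invr_gt0 sqrtr_gt0 lam_gt0.
have tk : 0 < t k by rewrite /t eqxx orbT invr_gt0 sqrtr_gt0 lam_gt0.
pose T := diag_op (u := u) t (m := m).
have T_sym : symmetric_op T := diag_op_symmetric t.
have Tu i : in_dim p i -> T (u i) = t i *: u i.
  move=> pi; rewrite /T (diag_op_basis u_onb _ pm)//.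
  case: (leqP i m) => [|mi]; first by rewrite mul1r.
  rewrite /t; case: ifP; rewrite ?mulr0//.
  by move: mi; rewrite /m gtn_max => /andP[ji ki]; rewrite !gtn_eqF.
pose c := Num.sqrt n%:R * (t j * t k) / C3.
have c0 : 0 < c by rewrite /c divr_gt0// !mulr_gt0// sqrtr_gt0.
pose W w := c * `|inner (Delta w (u j)) (u k)|.
have mD : measurable_fun setT (fun w => inner (Delta w (u j)) (u k)).
  exact: measurable_cov_diff.
have mW : measurable_fun setT W.
  by apply: measurable_funM; [exact: measurable_cst|exact: measurableT_comp].
have W0 w : 0 <= W w by rewrite mulr_ge0// ltW.
have tailW (y : R) : 2 <= y -> (P [set w | y < W w]%R <= (expR (- y))%:E)%E.
  move=> y2.
  have y0 : 0 < y by lra.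
  have [r [r0 r1 rr] rE] : exists2 r : R, [/\ 0 < r, 1 <= r & r ^+ 2 = n%:R]
      & r = Num.sqrt n%:R.
    exists (Num.sqrt n%:R) => //; split; first by rewrite sqrtr_gt0.
      by rewrite -[leLHS]sqrtr1 ler_wsqrtr// ler1n.
    by rewrite sqr_sqrtr// ltW.
  pose x := y / r.
  have x0 : 0 < x by rewrite divr_gt0.
  (* Here [n x = r y] and [n x^2 = y^2]; both are at least [y], because [r] and [y] are at least
     [1]. *)
  have nx : y <= n%:R * Num.min x (x ^+ 2).
    rewrite minr_pMr ?(ltW nR)// le_min /x -rr; apply/andP; split.
      rewrite [leRHS](_ : _ = r * y); last by field; rewrite gt_eqF.
      by rewrite ler_peMl// (ltW y0).
    rewrite [leRHS](_ : _ = y ^+ 2); last by field; rewrite gt_eqF.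
    by rewrite expr2 ler_peMl//; lra.
  have h := concentration_image
    T_sym (diag_op_bounded u_onb _ pm) Tu pj _ x0.
  rewrite t2// eqxx !mulr1 in h.
  have mO := measurable_cov_diff_opnorm T_sym
    (diag_op_bounded u_onb _ pm) lam_ge0.
  have p1 : in_dim p 1 by apply: (in_dim_le p _ _ pj) => //; exact: in_dim_gt0 pj.
  apply: le_trans (le_trans (h _ _) _); last 3 first.
  - move=> i pi; rewrite t2//; by case: (_ || _).
  - apply: (@le_trans _ _ 2%:E).
      rewrite (eseries_in_dim_finite _ _ m); last first.
        move=> i; rewrite /m gtn_max => /andP[ji ki].
        by rewrite /t !gtn_eqF//= expr0n mul0r.
      rewrite sumEFin lee_fin.
      have count1 i0 : \sum_(1 <= i < m.+1) (i == i0)%:R <= 1 :> R.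
        rewrite -natr_sum lern1 sum1_count_pred.
        by rewrite count_uniq_mem ?iota_uniq//; case: (_ \in _).
      apply: (@le_trans _ _ (\sum_(1 <= i < m.+1) ((i == j)%:R + (i == k)%:R))).
        rewrite big_mkcond; apply: ler_sum => i _; case: ifPn => [pi|_].
          by rewrite t2//; case: (i == j); case: (i == k); rewrite /=; lra.
        by rewrite addr_ge0.
      by rewrite big_split/= (_ : 2 = 1 + 1)// lerD.
    by rewrite lee_fin (le_trans y2).
  - by rewrite lee_fin ler_expR lerN2.
  apply: le_measure; rewrite ?inE.
  + rewrite (_ : [set w | _] = W @^-1` `]y, +oo[%classic).
      by rewrite -[X in measurable X]setTI; apply: mW => //; exact: measurable_itv.
    by apply/seteqP; split => w /=; rewrite in_itv/= andbT.
  + by apply: mO => //; rewrite mulr_ge0// ltW.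
  move=> w /= yW.
  have uj1 : `|u j| <= 1.
    by rewrite -(@ler_pXn2r _ 2)// ?nnegrE// expr1n -inner_norm u_onb.1// eqxx.
  have uk1 : `|u k| <= 1.
    by rewrite -(@ler_pXn2r _ 2)// ?nnegrE// expr1n -inner_norm u_onb.1// eqxx.
  apply: lt_le_trans (opnorm_ub _ _ uj1); rewrite lte_fin.
  have : t j * t k * `|inner (Delta w (u j)) (u k)| <=
      `|T ((S \- emp_cov Xs w) (T (u j)))|.
    apply: (@le_trans _ _ `|inner (T (Delta w (T (u j)))) (u k)|); last first.
      by apply: le_trans (ler_inner_norm _ _) _; rewrite ler_piMr.
    rewrite T_sym !Tu// /Delta (symmetric_opZ (cov_diff_symmetric Xs S w S_sym)).
    by rewrite innerZl innerZr !normrM (gtr0_norm tj) (gtr0_norm tk) mulrA.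
  apply: lt_le_trans.
  move: yW; rewrite /W /c /x -rE mulrAC ltr_pdivlMr// => yW.
  rewrite mulrA ltr_pdivrMr// (mulrC C3); apply: lt_le_trans yW _.
  by rewrite le_eqVlt; apply/orP; left; apply/eqP; ring.
have := tail_moment4 P W mW W0 tailW.
have -> : (fun w => (W w ^+ 4)%:E) =
    (fun w => (c ^+ 4)%:E * (inner (Delta w (u j)) (u k) ^+ 4)%:E)%E.
  apply/funext => w; rewrite -EFinM /W exprMn -normrX ger0_norm//.
  by rewrite (exprM _ 2 2) sqr_ge0.
rewrite ge0_integralZl_EFin//; last 3 first.
- by move=> w _; rewrite lee_fin (exprM _ 2 2) sqr_ge0.
- by apply/measurable_EFinP; apply: measurable_funX.
- by rewrite exprn_ge0// ltW.
rewrite -lee_pdivlMl ?exprn_gt0// => /le_trans; apply.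
rewrite -EFinM lee_fin /moment_constant le_eqVlt; apply/orP; left; apply/eqP.
rewrite /c /t !eqxx orbT /=.
have := sqr_sqrtr (lam_ge0 _ pj); have := sqr_sqrtr (lam_ge0 _ pk).
have := sqr_sqrtr (ltW nR).
have : 0 < Num.sqrt (lam j) by rewrite sqrtr_gt0 lam_gt0.
have : 0 < Num.sqrt (lam k) by rewrite sqrtr_gt0 lam_gt0.
have : 0 < Num.sqrt (n%:R : R) by rewrite sqrtr_gt0.
move: (Num.sqrt (lam j)) (Num.sqrt (lam k)) (Num.sqrt (n%:R : R)) => a b r.
move=> r0 b0 a0 <- <- <-; field.
by rewrite !gt_eqF.
Qed.

Let K := moment_constant.

(* AM-GM replaces the Cauchy-Schwarz inequality: [2 z <= theta z^2 / q + q / theta]. *)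
Lemma expect_cov_entry (E : set Om) (theta : R) j k :
  measurable E -> 0 < theta -> (P E <= (theta ^+ 2)%:E)%E ->
  in_dim p j -> in_dim p k ->
  (\int[P]_w (\1_E w * inner (Delta w (u j)) (u k) ^+ 2)%:E <=
    (K * theta * lam j / n%:R)%:E * (lam k)%:E)%E.
Proof.
move=> mE th0 PE pj pk.
pose q := lam j * lam k / n%:R.
have q0 : 0 < q by rewrite divr_gt0// mulr_gt0// lam_gt0.
set D := fun w => inner (Delta w (u j)) (u k).
have mD : measurable_fun setT D by exact: measurable_cov_diff.
have m1 : measurable_fun setT (\1_E : Om -> R) by exact/measurable_indicP.
have c1 : 0 <= theta / (2 * q) by rewrite divr_ge0 ?(ltW th0)// mulr_ge0// ltW.
have c2 : 0 <= q / (2 * theta) by rewrite divr_ge0 ?(ltW q0)// mulr_ge0// ltW.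
have mD4 : measurable_fun setT (fun w => (D w ^+ 4)%:E).
  by apply/measurable_EFinP; exact: measurable_funX.
have mE1 : measurable_fun setT (fun w => (\1_E w)%:E : \bar R).
  exact/measurable_EFinP.
have D40 w : (0 <= (D w ^+ 4)%:E)%E by rewrite lee_fin (exprM _ 2 2) sqr_ge0.
apply: (@le_trans _ _ (\int[P]_w ((theta / (2 * q))%:E * (D w ^+ 4)%:E +
    (q / (2 * theta))%:E * (\1_E w)%:E))%E).
  apply: ge0_le_integral => //=.
  - by move=> w _; rewrite lee_fin mulr_ge0// sqr_ge0.
  - apply/measurable_EFinP; apply: measurable_funM => //.
    exact: measurable_funX.
  - by apply: emeasurable_funD; exact: measurable_funeM.
  move=> w _; rewrite -!EFinM -EFinD lee_fin indicE -/(D w).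
  have [_|_] := boolP (w \in E); last first.
    rewrite /= mul0r mulr0 addr0 mulr_ge0//.
    by rewrite (exprM _ 2 2) sqr_ge0.
  rewrite /= mul1r mulr1 (exprM _ 2 2); move: (D w ^+ 2) => z.
  rewrite -subr_ge0 [leRHS](_ : _ = (theta * z - q) ^+ 2 / (2 * q * theta)).
    have q20 : 0 <= 2 * q * theta by rewrite mulr_ge0 ?(ltW th0)// mulr_ge0// ltW.
    by rewrite divr_ge0// sqr_ge0.
  by field; rewrite !gt_eqF.
rewrite ge0_integralD//=; last 4 first.
- by move=> w _; rewrite mule_ge0// lee_fin.
- exact: measurable_funeM.
- by move=> w _; rewrite mule_ge0// lee_fin.
- exact: measurable_funeM.
rewrite !ge0_integralZl_EFin//.
rewrite integral_indic// setIT.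
have := cov_entry_moment4 _ _ pj pk.
rewrite -/K -/q => hD.
apply: (@le_trans _ _ ((theta / (2 * q))%:E * (K * q ^+ 2)%:E +
    (q / (2 * theta))%:E * (theta ^+ 2)%:E)%E).
  by apply: leeD; apply: lee_wpmul2l; rewrite ?lee_fin.
rewrite -!EFinM -EFinD lee_fin.
have K1 : 1 <= K := moment_constant_ge1.
rewrite [leLHS](_ : _ = (K + 1) / 2 * (theta * q)); last first.
  by field; rewrite !gt_eqF.
rewrite [leRHS](_ : _ = K * (theta * q)); last by rewrite /q; field; rewrite gt_eqF.
have tq0 : 0 <= theta * q by rewrite mulr_ge0 ?(ltW th0)// ltW.
by rewrite ler_wpM2r//; lra.
Qed.

(** For [s = 0] the projection is an empty sum and the residual is [Delta w (u j)] itself; this case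
    serves on the exceptional event. *)
Definition residual s j w :=
  Delta w (u j) - proj_le u s (Delta w (u j)).

Lemma residual_series s j w : in_dim p s.+1 ->
  ((`|residual s j w| ^+ 2)%:E = \sum_(k <oo) (if in_dim p k && (s < k)%N
     then (inner (Delta w (u j)) (u k) ^+ 2)%:E else 0))%E.
Proof.
move=> ps; rewrite -(parseval p u_onb) eseries_in_dim.
apply: eq_eseriesr => k _.
case: (boolP (in_dim p k)) => //= pk; rewrite (in_dim_gt0 _ pk) /residual.
rewrite innerBr (inner_proj u_onb ps)// leqNgt (innerC (u k)).
by case: (s < k)%N; rewrite /= ?mul0r ?subr0// mul1r subrr expr0n.
Qed.

Lemma measurable_residual s j : in_dim p s.+1 ->
  measurable_fun setT (fun w => `|residual s j w|).
Proof.
move=> ps; apply: (measurable_norm_coords _ u_onb) => k pk.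
rewrite /residual; under eq_fun do rewrite innerBr (inner_proj u_onb ps)//.
apply: measurable_funB; last apply: measurable_funM.
- by under eq_fun do rewrite innerC; exact: measurable_cov_diff.
- exact: measurable_cst.
- by under eq_fun do rewrite innerC; exact: measurable_cov_diff.
Qed.

(** Parseval and monotone convergence reduce this to the bound for a single entry, summed over the
    indices beyond [s]. The full space with [theta = 1] gives the unrestricted expectation; the
    exceptional event gains the factor [theta]. *)
Lemma expect_residual (E : set Om) (theta : R) s j :
  measurable E -> 0 < theta -> (P E <= (theta ^+ 2)%:E)%E ->
  in_dim p s.+1 -> in_dim p j ->
  (\int[P]_w (\1_E w * `|residual s j w| ^+ 2)%:E <=
    (K * theta * lam j / n%:R)%:E * tr_gt p lam s)%E.
Proof.
move=> mE th0 PE ps pj.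
have c0 : 0 <= K * theta * lam j / n%:R.
  have K0 : 0 <= K by rewrite (le_trans ler01)// moment_constant_ge1.
  by rewrite divr_ge0// mulr_ge0 ?lam_ge0// mulr_ge0// ltW.
pose F k w : \bar R := if in_dim p k && (s < k)%N
     then (\1_E w * inner (Delta w (u j)) (u k) ^+ 2)%:E else 0%E.
have F0 k w : (0 <= F k w)%E.
  by rewrite /F; case: ifP => // _; rewrite lee_fin mulr_ge0 ?sqr_ge0.
have -> : (fun w => (\1_E w * `|residual s j w| ^+ 2)%:E) =
    (fun w => \sum_(k <oo) F k w)%E.
  apply/funext => w; rewrite EFinM residual_series// -nneseriesZl//.
    apply: eq_eseriesr => k _; rewrite /F; case: ifP => _; last by rewrite mule0.
    by rewrite EFinM.
  by move=> k _; case: ifP => // _; rewrite lee_fin sqr_ge0.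
rewrite integral_nneseries//; last first.
  move=> k; rewrite /F; case: (in_dim p k && (s < k)%N); last exact: measurable_cst.
  apply/measurable_EFinP; apply: measurable_funM; first exact/measurable_indicP.
  by apply: measurable_funX; exact: measurable_cov_diff.
rewrite /tr_gt eseries_in_dim -nneseriesZl; last first.
  by move=> k _; case: ifP => // /andP[pk _]; rewrite lee_fin lam_ge0.
apply: lee_nneseries => [k _ _|k _].
  by apply: integral_ge0 => w _; exact: F0.
rewrite /F; case: (boolP (in_dim p k && (s < k)%N)) => [/andP[pk _]|_].
  exact: expect_cov_entry.
by rewrite integral0 mule0.
Qed.

(** Parseval under the integral shows that the trace is at most the second moment of [|X|]. *)
Lemma trace_fin : sq_integrable P X -> (tr_gt p lam 0 < +oo)%E.
Proof.
rewrite /sq_integrable; apply: le_lt_trans; rewrite unlock.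
rewrite /tr_gt eseries_in_dim.
pose F k w : \bar R := if in_dim p k && (0 < k)%N
     then (inner (X w : H) (u k) ^+ 2)%:E else 0%E.
have F0 k w : (0 <= F k w)%E.
  by rewrite /F; case: ifP => // _; rewrite lee_fin sqr_ge0.
have -> : (fun w => (`|X w : H| ^+ 2)%:E) = (fun w => \sum_(k <oo) F k w)%E.
  apply/funext => w; rewrite -(parseval p u_onb) eseries_in_dim.
  by apply: eq_eseriesr => k _; rewrite /F innerC.
rewrite integral_nneseries//; last first.
  move=> k; rewrite /F; case: (in_dim p k && (0 < k)%N); last exact: measurable_cst.
  by apply/measurable_EFinP; apply: measurable_funX; exact: measurable_inner.
apply: lee_nneseries => [k _ _|k _].
  by case: ifP => // /andP[pk _]; rewrite lee_fin lam_ge0.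
rewrite /F; case: (boolP (in_dim p k && (0 < k)%N)) => [/andP[pk _]|_];
  last by rewrite integral0.
have -> : lam k = inner (S (u k)) (u k).
  by rewrite innerC (eigen_inner S_sym S_eig)// u_onb.1// eqxx mulr1.
rewrite (covariance_inner _ _ _ _ X_cov) unlock.
by rewrite le_eqVlt; apply/orP; left; apply/eqP; apply: eq_integral.
Qed.

Lemma tr_gt_ge0 r : (0 <= tr_gt p lam r)%E.
Proof. by apply: nneseries_ge0 => k _ pk; rewrite lee_fin lam_ge0. Qed.

Lemma tr_gt_le r s : (r <= s)%N -> (tr_gt p lam s <= tr_gt p lam r)%E.
Proof.
move=> rs; rewrite /tr_gt !eseries_in_dim; apply: lee_nneseries => [k _ _|k _].
  by case: ifP => // /andP[pk _]; rewrite lee_fin lam_ge0.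
case: (boolP (in_dim p k)) => //= pk.
case: ifP => [sk|_]; first by rewrite (leq_ltn_trans rs).
by case: ifP => //; rewrite lee_fin lam_ge0.
Qed.

Lemma lam_le_tr_gt r j : (r < j)%N -> in_dim p j ->
  ((lam j)%:E <= tr_gt p lam r)%E.
Proof.
move=> rj pj; rewrite /tr_gt eseries_in_dim (@nneseriesD1 _ _ j)//=.
  rewrite pj rj leeDl//; apply: nneseries_ge0 => k _ _.
  by case: ifP => // /andP[pk _]; rewrite lee_fin lam_ge0.
by move=> k _; case: ifP => // /andP[pk _]; rewrite lee_fin lam_ge0.
Qed.

(** * Deviation events for the weighted and the tail compressions *)

Context {d : nat}.
Hypothesis pd : in_dim p d.+1.
Local Notation gap j := (lam j - lam d.+1).

Lemma gap_mono i j : (0 < i)%N -> (i <= j)%N -> in_dim p j -> gap j <= gap i.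
Proof. by move=> i0 ij pj; rewrite lerD2r (eigen_le S_eig). Qed.

(** The ratio equals [1 - lam d.+1 / lam j], which increases with [lam j]. *)
Lemma gap_ratio_mono i j : (0 < i)%N -> (i <= j)%N -> in_dim p j ->
  gap j / lam j <= gap i / lam i.
Proof.
move=> i0 ij pj; have pi := in_dim_le p i0 ij pj.
rewrite ler_pdivrMr ?lam_gt0// mulrAC ler_pdivlMr ?lam_gt0//.
have h := eigen_le S_eig _ _ i0 ij pj.
rewrite !mulrBl (mulrC (lam j)) lerD2l lerN2 ler_wpM2l//.
exact: lam_ge0.
Qed.

Definition weight_op s := diag_op (u := u)
  (fun j => (Num.sqrt (lam j - lam d.+1))^-1) (m := s).

(* The threshold is [1 / 4] because its square, multiplied by the factor [8] lost in
   [subspace_error_bound], must stay below [1]. *)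
Definition weighted_event s : set Om := [set w | ((1 / 4)%:E <
  opnorm (fun v => weight_op s ((S \- emp_cov Xs w)%R (weight_op s v))))%E].

Lemma measurable_weighted_event s : (0 < s)%N -> (s <= d)%N ->
  measurable (weighted_event s).
Proof.
move=> s0 sd.
have ps : in_dim p s := in_dim_lt pd s0 sd.
apply: (measurable_cov_diff_opnorm (diag_op_symmetric _)
  (diag_op_bounded u_onb _ ps) lam_ge0) => //.
exact: (in_dim_le p _ _ pd).
Qed.

(** After weighting, the eigenvalues are [lam j / gap j] for [j <= s]; the largest is
    [lam s / gap s] and the trace is the gap sum. With [x] chosen so that the deviation threshold is
    [1 / 4], one has [x <= 1], and the trace condition multiplied by [lam s / gap s] is exactly the
    inequality in [gap_cond]. *)
Lemma probability_weighted_event s : (0 < s)%N -> (s <= d)%N ->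
  gap_cond C3 n lam d s ->
  (P (weighted_event s) <=
    (expR (- (n%:R * (gap s / lam s) ^+ 2 / (16 * C3 ^+ 2))))%:E)%E.
Proof.
move=> s0 sd [gs hs].
have ps : in_dim p s := in_dim_lt pd s0 sd.
have gs0 : 0 < gap s by rewrite subr_gt0.
have ls0 : 0 < lam s by exact: lam_gt0.
have l0 : 0 < lam d.+1 by exact: lam_gt0.
pose t j := (j <= s)%:R * (Num.sqrt (gap j))^-1.
have gj0 j : (0 < j)%N -> (j <= s)%N -> 0 < gap j.
  by move=> j0 js; exact: lt_le_trans (gap_mono _ _ j0 js ps).
have t2 j : in_dim p j -> (j <= s)%N -> t j ^+ 2 * lam j = lam j / gap j.
  move=> pj js; rewrite /t js mul1r exprVn sqr_sqrtr 1?mulrC//.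
  by rewrite ltW// gj0// (in_dim_gt0 _ pj).
have ts : t s ^+ 2 * lam s = lam s / gap s by exact: t2.
pose x := gap s / (4 * C3 * lam s).
have x0 : 0 < x by rewrite divr_gt0// !mulr_gt0.
have x1 : x <= 1.
  rewrite /x ler_pdivrMr ?mulr_gt0// mul1r.
  have : gap s <= lam s by rewrite gerBl ltW.
  move=> /le_trans; apply; rewrite ler_peMl ?(ltW ls0)//.
  by have := C3_gt1; lra.
have xmin : Num.min x (x ^+ 2) = x ^+ 2.
  by apply/min_idPr; rewrite expr2 ler_piMl// ltW.
have := concentration_image
  (diag_op_symmetric _) (diag_op_bounded u_onb _ ps)
  (diag_op_basis u_onb (fun j => (Num.sqrt (gap j))^-1) ps) ps _ x0.
rewrite -/(t s) ts xmin => h.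
rewrite /weighted_event; have -> : 1 / 4 = C3 * (lam s / gap s) * x.
  by rewrite /x; field; rewrite !gt_eqF.
have -> : n%:R * (gap s / lam s) ^+ 2 / (16 * C3 ^+ 2) = n%:R * x ^+ 2.
  by rewrite /x; field; rewrite !gt_eqF.
apply: h => [j pj|].
- rewrite -/(t j); have [js|sj] := leqP j s; last first.
    by rewrite /t leqNgt sj mul0r expr0n mul0r divr_ge0// ltW.
  rewrite t2// ler_pdivrMr ?gj0 ?(in_dim_gt0 _ pj)// mulrAC ler_pdivlMr//.
  have j0 := in_dim_gt0 _ pj.
  have := eigen_le S_eig _ _ j0 js ps.
  rewrite -(ler_pM2r l0); lra.
- rewrite (eseries_in_dim_finite _ _ s); last first.
    by move=> j sj; rewrite leqNgt sj mul0r expr0n mul0r.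
  rewrite big_nat_in_dim// sumEFin lee_fin.
  have -> : \sum_(1 <= j < s.+1) ((j <= s)%:R / Num.sqrt (gap j)) ^+ 2 * lam j =
      gap_sum lam d s.
    apply: eq_big_nat => j /andP[j0 js]; rewrite -/(t j) t2//.
    exact: (in_dim_le p j0 js ps).
  have gl0 : 0 < lam s / gap s by rewrite divr_gt0.
  rewrite -(ler_pM2l gl0); apply: le_trans hs _.
  rewrite le_eqVlt; apply/orP; left; apply/eqP; rewrite /x.
  by field; rewrite !gt_eqF.
Qed.

Definition tail_op (v : H) := v - proj_le u d v.

Lemma tail_op_symmetric : symmetric_op tail_op.
Proof.
by move=> x y; rewrite /tail_op innerBl innerBr proj_symmetric.
Qed.

Lemma tail_op_bounded v : `|tail_op v| <= 1 * `|v|.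
Proof. by rewrite mul1r; exact: (norm_proj_compl_le u_onb pd). Qed.

Lemma tail_op_basis j : in_dim p j -> tail_op (u j) = (d < j)%N%:R *: u j.
Proof.
move=> pj; apply: (onb_ext _ u_onb) => i pi.
rewrite innerBr (inner_proj u_onb pd)// innerZr u_onb.1//.
case: eqVneq => [<-|_]; last by rewrite !mulr0 subrr.
by rewrite !mulr1 leqNgt; case: (d < i)%N; rewrite /= ?subr0 ?subrr.
Qed.

Definition tail_event j : set Om := [set w | ((gap j / 2)%:E <
  opnorm (fun v => tail_op ((S \- emp_cov Xs w)%R (tail_op v))))%E].

Lemma measurable_tail_event j : (0 < j)%N -> (j <= d)%N ->
  measurable (tail_event j).
Proof.
move=> j0 jd.
apply: (measurable_cov_diff_opnorm tail_op_symmetric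
  tail_op_bounded lam_ge0) => //.
  exact: (in_dim_le p _ _ pd).
rewrite divr_ge0// subr_ge0 (eigen_le S_eig)//; exact: leqW.
Qed.

(* The two alternatives are the failure and the validity of the trace condition in
   the concentration inequality. *)
Lemma probability_tail_event j (trd : R) : (0 < j)%N -> (j <= d)%N ->
  0 < gap j -> (tr_gt p lam d = trd%:E)%E ->
  gap j ^+ 2 <= 4 * C3 ^+ 2 * lam j * trd / n%:R \/
  (P (tail_event j) <=
    (expR (- (n%:R * (gap j / lam j) ^+ 2 / (4 * C3 ^+ 2))))%:E)%E.
Proof.
move=> j0 jd gj0 trdE.
have pj : in_dim p j := in_dim_lt pd j0 jd.
have lj0 : 0 < lam j by exact: lam_gt0.
have l0 : 0 < lam d.+1 by exact: lam_gt0.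
have lj : lam d.+1 <= lam j by rewrite -subr_ge0 ltW.
have gl : gap j <= lam j by rewrite gerBl ltW.
pose x := gap j / (2 * C3 * lam d.+1).
have x0 : 0 < x by rewrite divr_gt0// !mulr_gt0.
(* The analogue of [x] with [lam j] in place of [lam d.+1]. It is at most [1] and at most [x], so
   [y ^+ 2] bounds the minimum of [x] and [x ^+ 2] from below. *)
pose y := gap j / (2 * C3 * lam j).
have y0 : 0 < y by rewrite divr_gt0// !mulr_gt0.
have yx : y <= x.
  rewrite /y /x ler_wpM2l ?(ltW gj0)// lef_pV2 ?posrE ?mulr_gt0//.
  by rewrite ler_wpM2l// mulr_ge0// ltW.
have y1 : y <= 1.
  rewrite /y ler_pdivrMr ?mulr_gt0// mul1r (le_trans gl)// ler_peMl ?(ltW lj0)//.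
  by have := C3_gt1; lra.
have yE : n%:R * (gap j / lam j) ^+ 2 / (4 * C3 ^+ 2) = n%:R * y ^+ 2.
  by rewrite /y; field; rewrite !gt_eqF.
have ymin : y ^+ 2 <= Num.min x (x ^+ 2).
  rewrite le_min; apply/andP; split; last first.
    by rewrite ler_pXn2r ?nnegrE ?(ltW x0) ?(ltW y0).
  by apply: le_trans yx; rewrite expr2 ler_piMl// ltW.
have [trs|trb] := leP trd (n%:R * lam d.+1 * Num.min x (x ^+ 2)).
  right; rewrite yE.
  have := concentration_image
    tail_op_symmetric tail_op_bounded tail_op_basis pd _ x0.
  rewrite ltnSn expr1n mul1r => h.
  have xE : gap j / 2 = C3 * lam d.+1 * x by rewrite /x; field; rewrite !gt_eqF.
  rewrite /tail_event xE; apply: le_trans (h _ _) _.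
  - move=> i pi; have [di|id] := ltnP d i.
      by rewrite expr1n mul1r (eigen_le S_eig).
    by rewrite expr0n mul0r ltW.
  - apply: (@le_trans _ _ (tr_gt p lam d)); last by rewrite trdE lee_fin.
    rewrite /tr_gt -eseries_in_dim_gt le_eqVlt; apply/orP; left; apply/eqP.
    apply: eq_eseriesr => i pi.
    by case: (d < i)%N; rewrite ?expr1n ?mul1r// expr0n mul0r.
  - by rewrite lee_fin ler_expR lerN2 ler_wpM2l// ltW.
(* The trace condition fails. If the minimum is [x], the resulting bound on [n * gap j] is linear
   and is multiplied by [gap j <= lam j]; if it is [x ^+ 2], the bound is already quadratic in
   [gap j]. *)
left; move: trb; rewrite /Num.min; case: ifPn => [xx|].
- move=> trb.
  have : n%:R * gap j <= 2 * C3 * trd.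
    have -> : n%:R * gap j = 2 * C3 * (n%:R * lam d.+1 * x).
      by rewrite /x; field; rewrite !gt_eqF.
    by rewrite ler_wpM2l ?mulr_ge0 ?ltW.
  move=> h; rewrite ler_pdivlMr// expr2.
  have trd0 : 0 <= trd.
    apply: ltW; apply: le_lt_trans trb.
    by rewrite mulr_ge0 ?(ltW x0)// mulr_ge0// ltW.
  apply: (@le_trans _ _ (lam j * (2 * C3 * trd))).
    rewrite [leLHS](_ : _ = gap j * (n%:R * gap j)); last by ring.
    by apply: ler_pM => //; rewrite ?mulr_ge0// ltW.
  rewrite mulrA (mulrC (lam j)) ler_wpM2r// ler_wpM2r ?(ltW lj0)//.
  rewrite expr2; have := C3_gt1; nra.
- move=> _ trb; rewrite ler_pdivlMr//.
  have : n%:R * gap j ^+ 2 <= 4 * C3 ^+ 2 * lam d.+1 * trd.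
    have -> : n%:R * gap j ^+ 2 =
      4 * C3 ^+ 2 * lam d.+1 * (n%:R * lam d.+1 * x ^+ 2).
      by rewrite /x; field; rewrite !gt_eqF.
    rewrite ler_wpM2l ?(ltW trb)// mulr_ge0 ?(ltW l0)// mulr_ge0// exprn_ge0//.
    exact: ltW.
  have trd0 : 0 <= trd.
    apply: ltW; apply: le_lt_trans trb.
    by rewrite mulr_ge0 ?sqr_ge0// mulr_ge0// ltW.
  rewrite mulrC => /le_trans; apply; rewrite ler_wpM2r// ler_wpM2l//.
  by rewrite mulr_ge0// exprn_ge0// ltW.
Qed.

(** * Error bounds for a fixed sample *)

Section Pointwise.
Context {w : Om} {lh : nat -> R} {f : nat -> H}.
Hypothesis f_eig : is_eigensystem p (emp_cov Xs w) lh f.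

Let f_onb : is_onb p f. Proof. by case: f_eig. Qed.
Let D_sym : symmetric_op (Delta w). Proof. exact: cov_diff_symmetric. Qed.
Let S'_sym : symmetric_op (emp_cov Xs w). Proof. exact: emp_cov_symmetric. Qed.
Let E (v : H) := v - proj_le f d v.
Let norm_u j : in_dim p j -> `|u j| = 1.
Proof.
by move=> pj; apply/eqP; rewrite -(@eqrXn2 _ 2)// expr1n -inner_norm u_onb.1// eqxx.
Qed.

Lemma norm_compl_basis_le1 j : in_dim p j -> `|E (u j)| ^+ 2 <= 1.
Proof.
move=> pj; rewrite -(expr1n _ 2) ler_pXn2r ?nnegrE// -(norm_u _ pj).
exact: (norm_proj_compl_le f_onb pd).
Qed.

(** On vectors orthogonal to [u 1, ..., u d] the operator [tail_op] is the identity, so the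
    quadratic form of [Delta w] is controlled by the compressed operator alone. The min-max bound
    then applies with [m = gap j / 2]. *)
Lemma eigenvalue_separation j : (0 < j)%N -> (j <= d)%N ->
  ~ tail_event j w ->
  lh d.+1 <= lam j - gap j / 2.
Proof.
move=> j0 jd nt.
have pj : in_dim p j := in_dim_lt pd j0 jd.
have g0 : 0 <= gap j / 2.
  by rewrite divr_ge0// subr_ge0 (eigen_le S_eig)//; exact: leqW.
rewrite (_ : lam j - gap j / 2 = lam d.+1 + gap j / 2); last by field.
apply: (eigenvalue_perturbation S_sym S_eig S'_sym f_eig pd) => v vu.
have tv : tail_op v = v.
  rewrite /tail_op [proj_le u d v](_ : _ = 0) ?subr0//.
  rewrite /proj_le big_nat_cond big1// => i /andP[/andP[i0 id] _].
  by rewrite /tensor vu// scale0r.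
have t_sym := tail_op_symmetric.
have DE : emp_cov Xs w v = S v - Delta w v by rewrite /Delta/= subKr.
have hD : `|tail_op (Delta w (tail_op v))| <=
    gap j / 2 * `|v|.
  apply: (@le_opnorm _ _ (fun v => tail_op
    (Delta w (tail_op v)))) => //.
    move=> a x; rewrite (symmetric_opZ t_sym) (symmetric_opZ D_sym).
    exact: symmetric_opZ.
  by rewrite leNgt; apply/negP.
rewrite DE innerBl lerD2l.
have : - inner (Delta w v) v <= `|inner (tail_op
     (Delta w (tail_op v))) v|.
  by rewrite t_sym tv -normrN ler_norm.
move=> /le_trans; apply; apply: le_trans (ler_inner_norm _ _) _.
by rewrite expr2 mulrA ler_wpM2r.
Qed.

Lemma eigenvector_separation j : (0 < j)%N -> (j <= d)%N -> 0 < gap j ->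
  ~ tail_event j w ->
  gap j * `|E (u j)| ^+ 2 <= 4 / gap j * `|E (Delta w (u j))| ^+ 2.
Proof.
move=> j0 jd g0 nt.
have pj : in_dim p j := in_dim_lt pd j0 jd.
have := eigenvector_perturbation S_eig S'_sym f_eig pd j _ pj
  (eigenvalue_separation _ j0 jd nt) (ltW (divr_gt0 g0 (ltr0n R 2))).
rewrite -(@ler_pXn2r _ 2)// ?nnegrE ?mulr_ge0 ?divr_ge0 ?(ltW g0)// => h.
rewrite [leLHS](_ : _ = 4 / gap j * (gap j / 2 * `|E (u j)|) ^+ 2); last first.
  by field; rewrite gt_eqF.
by rewrite ler_wpM2l// divr_ge0// ltW.
Qed.

(** The left side is the squared Hilbert-Schmidt norm of a product: the family of vectors
    [sqrt (gap i) E (u i)], [i <= s], composed with the matrix of [T Delta T] for [T = weight_op s].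
    Off the weighted event that matrix has norm at most [1 / 4], whence the factor [1 / 16]. *)
Lemma weighted_contraction s : (0 < s)%N -> (s <= d)%N ->
  0 < gap s ->
  ~ weighted_event s w ->
  \sum_(1 <= j < s.+1) `|E (proj_le u s (Delta w (u j)))| ^+ 2 / gap j <=
  1 / 16 * \sum_(1 <= i < s.+1) gap i * `|E (u i)| ^+ 2.
Proof.
move=> s0 sd gs0 nw.
have ps : in_dim p s := in_dim_lt pd s0 sd.
have ps1 : in_dim p s.+1 by apply: (in_dim_le p _ _ pd).
have psn j : (1 <= j < s.+1)%N -> in_dim p j := in_dim_nat ps1.
have gj0 j : (1 <= j < s.+1)%N -> 0 < gap j.
  move=> /andP[j0 js]; apply: (lt_le_trans gs0).
  by rewrite lerD2r (eigen_le S_eig).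
have E_sym : symmetric_op E.
  by move=> x y; rewrite /E innerBl innerBr proj_symmetric.
pose T := weight_op s.
have T_sym : symmetric_op T := diag_op_symmetric _.
have hT x : `|T (Delta w (T x))| <= 1 / 4 * `|x|.
  apply: (@le_opnorm _ _ (fun x => T (Delta w (T x)))).
  - move=> a v; rewrite (symmetric_opZ T_sym) (symmetric_opZ D_sym).
    exact: symmetric_opZ.
  - by rewrite divr_ge0.
  - by rewrite leNgt; apply/negP.
have step h : \sum_(1 <= j < s.+1) inner h (E (proj_le u s (Delta w (u j)))) ^+ 2 / gap j
    <= 1 / 16 * \sum_(1 <= i < s.+1) gap i * inner h (E (u i)) ^+ 2.
  (* For a fixed direction [h], the vector [x] collects the weighted coordinates, and applying the
     weight cancels the square roots. Bessel for [T (Delta w (T x))] then gives the one-dimensional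
     form of the claim. *)
  pose x := \sum_(1 <= i < s.+1) (Num.sqrt (gap i) * inner h (E (u i))) *: u i.
  have xu i : in_dim p i -> inner (u i) x =
      (i <= s)%N%:R * (Num.sqrt (gap i) * inner h (E (u i))).
    move=> pi.
    rewrite /x inner_sumr; have [is_|si] := leqP i s.
      rewrite (bigD1_seq i) ?iota_uniq ?mem_index_iota ?(in_dim_gt0 _ pi)//=.
      rewrite innerZr u_onb.1// eqxx mulr1 mul1r big_nat_cond big1 ?addr0//.
      move=> k /andP[/psn pk ki].
      by rewrite innerZr u_onb.1// eq_sym (negbTE ki) mulr0.
    rewrite mul0r big_nat_cond big1// => k /andP[/[dup] /psn pk /andP[_ ks] _].
    by rewrite innerZr u_onb.1// gtn_eqF ?mulr0//; exact: leq_trans si.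
  have Tx : T x = \sum_(1 <= i < s.+1) inner h (E (u i)) *: u i.
    rewrite /T /weight_op /diag_op; apply: eq_big_nat => i iS.
    have /andP[_ is_] := iS.
    rewrite xu ?psn// -ltnS is_ mul1r mulrA mulVf ?mul1r//.
    by rewrite gt_eqF// sqrtr_gt0 gj0.
  have xx : `|x| ^+ 2 = \sum_(1 <= i < s.+1) gap i * inner h (E (u i)) ^+ 2.
    rewrite -inner_norm {1}/x inner_suml; apply: eq_big_nat => i iS.
    have /andP[_ is_] := iS.
    rewrite innerZl xu ?psn// -ltnS is_ mul1r -expr2 exprMn sqr_sqrtr//.
    by rewrite ltW// gj0.
  have Tj j : (1 <= j < s.+1)%N -> inner (u j) (T (Delta w (T x))) ^+ 2 =
      inner h (E (proj_le u s (Delta w (u j)))) ^+ 2 / gap j.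
    move=> jS; have /andP[_ js] := jS.
    rewrite -T_sym /T /weight_op (diag_op_basis u_onb _ ps) ?psn//.
    rewrite -ltnS js mul1r innerZl exprMn exprVn sqr_sqrtr ?(ltW (gj0 _ jS))// mulrC.
    congr (_ ^+ 2 / _).
    rewrite -/(weight_op s) -/T Tx -D_sym inner_sumr -E_sym innerC inner_projl.
    apply: eq_big_nat => i _; rewrite innerZr (innerC (Delta w _)) mulrC.
    by rewrite -(E_sym h) (innerC (E h)).
  rewrite -xx.
  have -> : 1 / 16 * `|x| ^+ 2 = (1 / 4 * `|x|) ^+ 2 by field.
  apply: (@le_trans _ _ (`|T (Delta w (T x))| ^+ 2)); last first.
    by rewrite ler_pXn2r ?nnegrE ?mulr_ge0 ?divr_ge0.
  apply: le_trans (bessel p u_onb s _).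
  rewrite big_nat_in_dim// le_eqVlt; apply/orP; left; apply/eqP.
  by apply: eq_big_nat => j jS; rewrite Tj.
(* The estimate is summed over the directions [h = u k]: Parseval recovers the squared norms on the
   left in the limit, and Bessel bounds the right. *)
have cv : (\sum_(1 <= j < s.+1) (\sum_(1 <= k < N.+1 | in_dim p k)
     inner (u k) (E (proj_le u s (Delta w (u j)))) ^+ 2) / gap j) @[N --> \oo] -->
    \sum_(1 <= j < s.+1) `|E (proj_le u s (Delta w (u j)))| ^+ 2 / gap j.
  apply: cvg_big => [|j _]; first exact: add_continuous.
  by apply: cvgMl; exact: parseval_cvg.
rewrite -(cvg_lim _ cv)//; apply: limr_le; first by apply/cvg_ex; eexists; exact: cv.
apply: nearW => N.
under eq_bigr do rewrite mulr_suml.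
rewrite exchange_big/=.
apply: (@le_trans _ _ (\sum_(1 <= k < N.+1 | in_dim p k)
  (1 / 16 * \sum_(1 <= i < s.+1) gap i * inner (u k) (E (u i)) ^+ 2))).
  by apply: ler_sum => k _; exact: step.
rewrite -mulr_sumr ler_wpM2l ?divr_ge0// exchange_big/= big_nat_cond [leRHS]big_nat_cond.
apply: ler_sum => i /andP[iS _]; rewrite -mulr_sumr ler_wpM2l ?(ltW (gj0 _ iS))//.
exact: bessel.
Qed.

Lemma subspace_error_bound_simple s : (0 < s)%N -> (s <= d)%N -> 0 < gap s ->
  \sum_(1 <= j < s.+1) gap j * `|E (u j)| ^+ 2 <=
  \sum_(1 <= j < s.+1) (gap j * \1_(tail_event j) w +
    Num.min (gap j) (4 / gap j * `|Delta w (u j)| ^+ 2)).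
Proof.
move=> s0 sd gs0; rewrite big_nat_cond [leRHS]big_nat_cond.
apply: ler_sum => j /andP[/andP[j0 js] _].
have jd : (j <= d)%N by apply: leq_trans sd.
have pj : in_dim p j := in_dim_lt pd j0 jd.
have g0 : 0 < gap j.
  by apply: (lt_le_trans gs0); rewrite lerD2r (eigen_le S_eig) ?(in_dim_lt pd s0).
have ga : gap j * `|E (u j)| ^+ 2 <= gap j.
  by rewrite ler_piMr ?(ltW g0)// norm_compl_basis_le1.
have c0 : 0 <= 4 / gap j by rewrite divr_ge0// ltW.
rewrite indicE; have [_|/negP nt] := boolP (w \in _).
  rewrite /= mulr1 (le_trans ga)// lerDl le_min (ltW g0)/=.
  by rewrite mulr_ge0// sqr_ge0.
rewrite /= mulr0 add0r le_min ga/=.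
apply: le_trans (eigenvector_separation _ j0 jd g0 _) _.
  by move=> t; apply: nt; rewrite inE.
by rewrite ler_wpM2l// ler_pXn2r ?nnegrE//; exact: (norm_proj_compl_le f_onb pd).
Qed.

Lemma subspace_error_bound s : (0 < s)%N -> (s <= d)%N -> 0 < gap s ->
  ~ weighted_event s w ->
  \sum_(1 <= j < s.+1) gap j * `|E (u j)| ^+ 2 <=
  \sum_(1 <= j < s.+1) 2 * (gap j * \1_(tail_event j) w +
    Num.min (gap j) (8 / gap j * `|residual s j w| ^+ 2)).
Proof.
move=> s0 sd gs0 nw; rewrite -mulr_sumr.
have := weighted_contraction _ s0 sd gs0 nw.
set Z := (X in X <= _); set A := (X in _ <= 1 / 16 * X) => contr.
set B := \sum_(1 <= j < s.+1) (_ + _).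
(* Absorption: the contracted part is at most [8 / 16] of the left side itself, so moving it over
   costs a factor [2]. *)
have arith (a b z : R) : z <= 1 / 16 * a -> a <= b + 8 * z -> a <= 2 * b by lra.
apply: arith contr _.
rewrite /B /Z mulr_sumr -big_split/= /A [leLHS]big_nat_cond [leRHS]big_nat_cond.
apply: ler_sum => j /andP[/andP[j0 js] _].
have jd : (j <= d)%N by apply: leq_trans sd.
have pj : in_dim p j := in_dim_lt pd j0 jd.
have g0 : 0 < gap j.
  by apply: (lt_le_trans gs0); rewrite lerD2r (eigen_le S_eig) ?(in_dim_lt pd s0).
have ga : gap j * `|E (u j)| ^+ 2 <= gap j.
  by rewrite ler_piMr ?(ltW g0)// norm_compl_basis_le1.
set r := residual s j w; set q := proj_le u s (Delta w (u j)).
have c0 : 0 <= 8 / gap j by rewrite divr_ge0// ltW.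
have m0 : 0 <= Num.min (gap j) (8 / gap j * `|r| ^+ 2).
  by rewrite le_min (ltW g0) mulr_ge0// sqr_ge0.
have q0 : 0 <= 8 * (`|E q| ^+ 2 / gap j).
  by rewrite mulr_ge0// divr_ge0 ?sqr_ge0// ltW.
rewrite indicE; have [_|/negP nt] := boolP (w \in _).
  by rewrite /= mulr1; lra.
rewrite /= mulr0 add0r.
have : gap j * `|E (u j)| ^+ 2 <= 8 * (`|E q| ^+ 2 / gap j) + 8 / gap j * `|r| ^+ 2.
  apply: le_trans (eigenvector_separation _ j0 jd g0 _) _.
    by move=> t; apply: nt; rewrite inE.
  (* The square of the sum of two components costs a factor [2], which turns [4 / gap j] into
     [8 / gap j]. *)
  have -> : E (Delta w (u j)) = E q + E r.
    rewrite /E /r /residual -/q addrACA -opprD; congr (_ - _).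
      by rewrite subrKC.
    have := symmetric_opP (@proj_symmetric _ _ f d) 1 q (Delta w (u j) - q).
    by rewrite !scale1r subrKC.
  have h := normD_sqr_le (E q) (E r).
  have h2 : `|E r| ^+ 2 <= `|r| ^+ 2.
    by rewrite ler_pXn2r ?nnegrE//; exact: (norm_proj_compl_le f_onb pd).
  rewrite [leRHS](_ : _ = 4 / gap j * (2 * `|E q| ^+ 2 + 2 * `|r| ^+ 2)); last first.
    by field; rewrite gt_eqF.
  by rewrite ler_wpM2l ?divr_ge0 ?(ltW g0)//; lra.
by rewrite /Num.min; case: ifP => _; lra.
Qed.

End Pointwise.

(** * Integrable majorants of the subspace error *)

Context {lamhat : nat -> Om -> R} {uhat : nat -> Om -> H}.
Hypothesis hat_eig : forall w, is_eigensystem p (emp_cov Xs w)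
  (fun j => lamhat j w) (fun j => uhat j w).

Definition subspace_error s w : R := \sum_(1 <= j < s.+1)
  gap j * `|u j - proj_le (fun k => uhat k w) d (u j)| ^+ 2.

(* The minima are the contributions of the residuals on and off the exceptional
   event; taking [b = b' = 0] leads to the local bound, while nonzero [b] and [b']
   interpolate [min (g, k r / g)] by the square root of [k r] for the global one. *)
Lemma subspace_error_majorant s (theta trs tr0 : R) (pi a b a' b' : nat -> R) :
  (0 < s)%N -> (s <= d)%N -> 0 < gap s ->
  0 < theta -> (P (weighted_event s) <= (theta ^+ 2)%:E)%E ->
  (tr_gt p lam s = trs%:E)%E -> (tr_gt p lam 0 = tr0%:E)%E ->
  (forall j, (1 <= j < s.+1)%N -> (P (tail_event j) <= (pi j)%:E)%E) ->
  (forall j, (1 <= j < s.+1)%N -> [/\ 0 <= a j, 0 <= b j, 0 <= a' j & 0 <= b' j]) ->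
  (forall j r, (1 <= j < s.+1)%N -> 0 <= r ->
     Num.min (gap j) (8 / gap j * r) <= a j * r + b j) ->
  (forall j r, (1 <= j < s.+1)%N -> 0 <= r ->
     Num.min (gap j) (4 / gap j * r) <= a' j * r + b' j) ->
  exists G : Om -> R, [/\ measurable_fun setT G,
    forall w, subspace_error s w <= G w &
    (\int[P]_w (G w)%:E <= (\sum_(1 <= j < s.+1)
      (3 * gap j * pi j + 2 * (a j * (K * lam j / n%:R * trs) + b j) +
       (a' j * (K * theta * lam j / n%:R * tr0) + b' j * theta ^+ 2)))%:E)%E].
Proof.
move=> s0 sd gs0 th0 Pbad trsE tr0E Ptail ab0 minb mina.
have ps : in_dim p s := in_dim_lt pd s0 sd.
have ps1 : in_dim p s.+1 by apply: (in_dim_le p _ _ pd).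
have p1 : in_dim p 1 by apply: (in_dim_le p _ _ pd).
have gj0 j : (1 <= j < s.+1)%N -> 0 < gap j.
  by move=> /andP[j0 js]; apply: (lt_le_trans gs0); rewrite lerD2r (eigen_le S_eig).
have mtail j : (1 <= j < s.+1)%N -> measurable (tail_event j).
  move=> /andP[j0 js]; apply: (measurable_tail_event) => //.
  by apply: leq_trans sd.
have mbad : measurable (weighted_event s).
  exact: (measurable_weighted_event).
(* One integrand serves on and off the weighted event: the coefficient [3] dominates the
   coefficients [1] and [2] of the tail indicator in the two pointwise bounds. It involves only
   events and residuals, so the empirical eigenvectors do not enter its measurability. *)
pose h j w : R := if (1 <= j < s.+1)%N then
  3 * gap j * \1_(tail_event j) w + 2 * a j * (\1_[set: Om] w * `|residual s j w| ^+ 2) +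
  2 * b j + a' j * (\1_(weighted_event s) w * `|residual 0 j w| ^+ 2) +
  b' j * \1_(weighted_event s) w else 0.
have ind0 (E : set Om) w : 0 <= \1_E w :> R by rewrite indicE.
have hterm0 j w : (1 <= j < s.+1)%N -> [/\ 0 <= 3 * gap j * \1_(tail_event j) w,
   0 <= 2 * a j * (\1_[set: Om] w * `|residual s j w| ^+ 2), 0 <= 2 * b j,
   0 <= a' j * (\1_(weighted_event s) w * `|residual 0 j w| ^+ 2) &
   0 <= b' j * \1_(weighted_event s) w].
  move=> jS; have [a0 b0 a'0 b'0] := ab0 j jS; split.
  - by rewrite mulr_ge0// mulr_ge0// ltW// gj0.
  - by rewrite mulr_ge0// mulr_ge0// sqr_ge0.
  - by rewrite mulr_ge0.
  - by rewrite mulr_ge0// mulr_ge0// sqr_ge0.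
  - by rewrite mulr_ge0.
have h0 j w : 0 <= h j w.
  rewrite /h; case: ifP => // jS; have [] := hterm0 j w jS => *.
  by rewrite !addr_ge0.
have m1 (E : set Om) : measurable E -> measurable_fun setT (\1_E : Om -> R).
  by move=> mE; exact/measurable_indicP.
have mres t j : in_dim p t.+1 -> measurable_fun setT (fun w => `|residual t j w| ^+ 2).
  by move=> pt; apply: measurable_funX; exact: (measurable_residual).
have mi (E : set Om) t j : measurable E -> in_dim p t.+1 ->
   measurable_fun setT (fun w => \1_E w * `|residual t j w| ^+ 2).
  by move=> mE pt; apply: measurable_funM; [exact: m1|exact: mres].
have mc (c : R) (f : Om -> R) : measurable_fun setT f ->
   measurable_fun setT (fun w => c * f w).
  by move=> mf; apply: measurable_funM => //; exact: measurable_cst.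
have mh j : measurable_fun setT (h j).
  rewrite /h; case: (boolP (1 <= j < s.+1)%N) => jS; last exact: measurable_cst.
  apply: measurable_funD; last by apply: mc; exact: m1.
  apply: measurable_funD; last by apply: mc; exact: mi.
  apply: measurable_funD; last exact: measurable_cst.
  apply: measurable_funD; last by apply: mc; exact: mi.
  by apply: mc; apply: m1; exact: mtail.
exists (fun w => \sum_(1 <= j < s.+1) h j w); split.
- exact: measurable_sum.
- move=> w.
  have [wb|wb] := boolP (w \in weighted_event s).
    apply: le_trans (subspace_error_bound_simple (hat_eig w) _ s0 sd gs0) _.
    rewrite big_nat_cond [leRHS]big_nat_cond; apply: ler_sum => j /andP[jS _].
    have := mina j (`|Delta w (u j)| ^+ 2) jS (sqr_ge0 _).
    have [] := hterm0 j w jS => t1 t2 t3 t4 t5.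
    have DE : Delta w (u j) = residual 0 j w.
      by rewrite /residual /proj_le big_geq// subr0.
    have eb : \1_(weighted_event s) w = 1 :> R by rewrite indicE wb.
    rewrite /h jS; rewrite eb mul1r in t4; rewrite eb mulr1 in t5.
    rewrite eb mul1r mulr1 DE => h2.
    have t6 : gap j * \1_(tail_event j) w <= 3 * gap j * \1_(tail_event j) w.
      have gi0 : 0 <= gap j * \1_(tail_event j) w by rewrite mulr_ge0// ltW// gj0.
      by rewrite -mulrA; lra.
    lra.
  have nb : ~ weighted_event s w by move: wb; rewrite notin_setE.
  apply: le_trans (subspace_error_bound (hat_eig w) _ s0 sd gs0 nb) _.
  rewrite big_nat_cond [leRHS]big_nat_cond; apply: ler_sum => j /andP[jS _].
  have := minb j (`|residual s j w| ^+ 2) jS (sqr_ge0 _).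
  have [] := hterm0 j w jS => t1 t2 t3 t4 t5.
  rewrite /h jS indicT/= mul1r => h2.
  have t6 : 2 * (gap j * \1_(tail_event j) w) <= 3 * gap j * \1_(tail_event j) w.
    have gi0 : 0 <= gap j * \1_(tail_event j) w by rewrite mulr_ge0// ltW// gj0.
    by rewrite -mulrA; lra.
  lra.
under eq_integral do rewrite -sumEFin.
rewrite ge0_integral_sum//=; last 2 first.
- by move=> j; exact/measurable_EFinP.
- by move=> j w _; rewrite lee_fin.
rewrite -sumEFin big_nat_cond [leRHS]big_nat_cond.
apply: lee_sum => j /andP[jS _].
have [a0 b0 a'0 b'0] := ab0 j jS.
have pj : in_dim p j := in_dim_nat ps1 jS.
have g0 := gj0 j jS.
have PT : (P [set: Om] <= (1 ^+ 2)%:E)%E by rewrite probability_setT expr1n.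
have resS := expect_residual _ _ s j measurableT ltr01 PT ps1 pj.
have res0 := expect_residual _ _ 0 j mbad th0 Pbad p1 pj.
rewrite trsE -EFinM mulr1 -/K in resS.
rewrite tr0E -EFinM -/K in res0.
have Ebad : (\int[P]_w (\1_(weighted_event s) w)%:E = P (weighted_event s))%E.
  by rewrite integral_indic// setIT.
have Etail : (\int[P]_w (\1_(tail_event j) w)%:E = P (tail_event j))%E.
  by rewrite integral_indic ?setIT//; exact: mtail.
rewrite /h jS.
have -> : (fun w => (3 * gap j * \1_(tail_event j) w +
   2 * a j * (\1_[set: Om] w * `|residual s j w| ^+ 2) +
   2 * b j + a' j * (\1_(weighted_event s) w * `|residual 0 j w| ^+ 2) +
   b' j * \1_(weighted_event s) w)%:E) =
  (fun w => (3 * gap j)%:E * (\1_(tail_event j) w)%:E +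
   ((2 * a j)%:E * (\1_[set: Om] w * `|residual s j w| ^+ 2)%:E +
   ((2 * b j)%:E + ((a' j)%:E * (\1_(weighted_event s) w * `|residual 0 j w| ^+ 2)%:E +
    (b' j)%:E * (\1_(weighted_event s) w)%:E))))%E.
  by apply/funext => w; rewrite -!EFinM -!EFinD !addrA.
have me (c : R) (f : Om -> R) : measurable_fun setT f ->
   measurable_fun setT (fun w => c%:E * (f w)%:E)%E.
  by move=> mf; apply: measurable_funeM; exact/measurable_EFinP.
have i0 (E : set Om) t w : 0 <= \1_E w * `|residual t j w| ^+ 2.
  by rewrite mulr_ge0// sqr_ge0.
have c1 : 0 <= 3 * gap j by rewrite mulr_ge0// ltW.
have c2 : 0 <= 2 * a j by rewrite mulr_ge0.
have c3 : 0 <= 2 * b j by rewrite mulr_ge0.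
have mt := mtail j jS.
have f1 w : (0 <= (3 * gap j)%:E * (\1_(tail_event j) w)%:E)%E.
  by rewrite mule_ge0// lee_fin.
have f2 w : (0 <= (2 * a j)%:E * (\1_[set: Om] w * `|residual s j w| ^+ 2)%:E)%E.
  by rewrite mule_ge0// lee_fin.
have f4 w : (0 <= (a' j)%:E * (\1_(weighted_event s) w * `|residual 0 j w| ^+ 2)%:E)%E.
  by rewrite mule_ge0// lee_fin.
have f5 w : (0 <= (b' j)%:E * (\1_(weighted_event s) w)%:E)%E.
  by rewrite mule_ge0// lee_fin.
have m4 := me (a' j) _ (mi _ _ j mbad p1).
have m5 := me (b' j) _ (m1 _ mbad).
have m2 := me (2 * a j) _ (mi _ _ j measurableT ps1).
have m345 : measurable_fun setT (fun w => (2 * b j)%:E +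
    ((a' j)%:E * (\1_(weighted_event s) w * `|residual 0 j w| ^+ 2)%:E +
    (b' j)%:E * (\1_(weighted_event s) w)%:E))%E.
  apply: emeasurable_funD; first exact: measurable_cst.
  exact: emeasurable_funD.
rewrite ge0_integralD//=; last 3 first.
- by apply: me; exact: m1.
- move=> w _; apply: adde_ge0 => //; apply: adde_ge0; first by rewrite lee_fin.
  exact: adde_ge0.
- exact: emeasurable_funD.
rewrite ge0_integralD//=; last first.
  by move=> w _; apply: adde_ge0; [rewrite lee_fin|exact: adde_ge0].
rewrite ge0_integralD//=; last 2 first.
- by move=> w _; exact: adde_ge0.
- exact: emeasurable_funD.
rewrite ge0_integralD//=.
rewrite integral_cst//= [P _]probability_setT mule1.
rewrite ge0_integralZl_EFin//=; last by apply/measurable_EFinP; exact: m1.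
rewrite ge0_integralZl_EFin//=; last by apply/measurable_EFinP; exact: mi.
rewrite ge0_integralZl_EFin//=; last by apply/measurable_EFinP; exact: mi.
rewrite ge0_integralZl_EFin//=; last by apply/measurable_EFinP; exact: m1.
rewrite Ebad Etail.
apply: (@le_trans _ _ ((3 * gap j)%:E * (pi j)%:E +
  ((2 * a j)%:E * (K * lam j / n%:R * trs)%:E + ((2 * b j)%:E +
   ((a' j)%:E * (K * theta * lam j / n%:R * tr0)%:E +
    (b' j)%:E * (theta ^+ 2)%:E))))%E).
  apply: leeD; first by rewrite lee_wpmul2l ?lee_fin ?Ptail.
  apply: leeD; first by rewrite lee_wpmul2l ?lee_fin.
  apply: leeD => //.
  by apply: leeD; rewrite lee_wpmul2l ?lee_fin.
rewrite -!EFinM -!EFinD lee_fin le_eqVlt; apply/orP; left; apply/eqP; ring.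
Qed.

(** The square root of the probability bound for the weighted event, hence [32] in place of [16]; it
    plays the role of [theta] in the moment bounds. *)
Definition decay_rate s : R :=
  expR (- (n%:R * (gap s / lam s) ^+ 2 / (32 * C3 ^+ 2))).

Lemma decay_rate_gt0 s : 0 < decay_rate s. Proof. exact: expR_gt0. Qed.

Lemma decay_rate_le1 s : decay_rate s <= 1.
Proof.
by rewrite -[leRHS]expR0 ler_expR oppr_le0 divr_ge0// mulr_ge0// sqr_ge0.
Qed.

Lemma decay_rate_sqr s : decay_rate s ^+ 2 =
  expR (- (n%:R * (gap s / lam s) ^+ 2 / (16 * C3 ^+ 2))).
Proof.
rewrite /decay_rate expr2 -expRD; congr expR.
by move: (gap s / lam s) => y; field; rewrite gt_eqF.
Qed.

Lemma expRN_le_inv (m : R) : 0 < m -> expR (- m) <= m^-1.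
Proof.
move=> m0; rewrite expRN lef_pV2 ?posrE ?expR_gt0//.
by apply: le_trans (expR_ge1Dx _); rewrite lerDr.
Qed.

Lemma expRN_sqr_le_inv (z : R) : 0 < z -> expR (- (2 * z ^+ 2)) <= (2 * z)^-1.
Proof.
move=> z0; rewrite expRN lef_pV2 ?posrE ?expR_gt0 ?mulr_gt0//.
apply: le_trans (expR_ge1Dx _); have := sqr_ge0 (1 - z); nra.
Qed.

(** If the trace condition fails, the trivial mass [x = 1] works because [gap j] is then small.
    Otherwise the exponential bound is split into two equal factors: one is at most [decay_rate s],
    the other is traded for an inverse power, of order [gap j ^ -2] for the first estimate and
    [gap j ^ -1] for the second. *)
Lemma tail_event_mass s j (trd tr0 : R) :
  (tr_gt p lam d = trd%:E)%E -> (tr_gt p lam 0 = tr0%:E)%E ->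
  (0 < j)%N -> (j <= s)%N -> (s <= d)%N -> 0 < gap s ->
  exists x : R, [/\ (P (tail_event j) <= x%:E)%E,
    3 * gap j * x <= 24 * C3 ^+ 2 / n%:R * (trd + tr0 * decay_rate s) * (lam j / gap j) &
    3 * gap j * x <= 6 * C3 / Num.sqrt n%:R *
      (Num.sqrt trd + Num.sqrt tr0 * decay_rate s) * Num.sqrt (lam j)].
Proof.
move=> trdE tr0E j0 js sd gs0.
have jd := leq_trans js sd.
have s0 : (0 < s)%N := leq_trans j0 js.
have ps : in_dim p s := in_dim_lt pd s0 sd.
have pj : in_dim p j := in_dim_lt pd j0 jd.
have lj : 0 < lam j := lam_gt0 _ pj.
have g0 : 0 < gap j by apply: (lt_le_trans gs0); rewrite lerD2r (eigen_le S_eig).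
have ljtr : lam j <= tr0 by rewrite -lee_fin -tr0E (lam_le_tr_gt).
have trd0 : 0 <= trd by rewrite -lee_fin -trdE (tr_gt_ge0).
have tr00 : 0 <= tr0 by rewrite (le_trans _ ljtr)// ltW.
have th0 := decay_rate_gt0 s.
set th := decay_rate s in th0 *.
have [r [r0 rr rE]] : exists r : R, [/\ 0 < r, r ^+ 2 = n%:R & r = Num.sqrt n%:R].
  by exists (Num.sqrt n%:R); rewrite sqrtr_gt0 sqr_sqrtr//; exact: ltW.
have [a [a0 aa aE]] : exists a : R, [/\ 0 < a, a ^+ 2 = lam j & a = Num.sqrt (lam j)].
  by exists (Num.sqrt (lam j)); rewrite sqrtr_gt0 sqr_sqrtr//; exact: ltW.
have [t [t0 tt tE]] : exists t : R, [/\ 0 <= t, t ^+ 2 = trd & t = Num.sqrt trd].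
  by exists (Num.sqrt trd); rewrite sqrtr_ge0 sqr_sqrtr.
have [v [v0 vv vE]] : exists v : R, [/\ 0 <= v, v ^+ 2 = tr0 & v = Num.sqrt tr0].
  by exists (Num.sqrt tr0); rewrite sqrtr_ge0 sqr_sqrtr.
rewrite -rE -aE -tE -vE.
have c24 : 0 <= 24 * C3 ^+ 2 / n%:R by rewrite divr_ge0// mulr_ge0// sqr_ge0.
have c6 : 0 <= 6 * C3 / r by rewrite divr_ge0 ?(ltW r0)// mulr_ge0// ltW.
have av : a <= v by rewrite -(@ler_pXn2r _ 2) ?nnegrE ?(ltW a0)// aa vv.
have mt : measurable (tail_event j).
  exact: (measurable_tail_event).
case: (probability_tail_event _ _ j0 jd g0 trdE) => [hg|hP].
- exists 1; rewrite mulr1; split; first exact: probability_le1.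
    apply: (@le_trans _ _ (24 * C3 ^+ 2 / n%:R * trd * (lam j / gap j))).
      rewrite [leRHS](_ : _ = 6 * (4 * C3 ^+ 2 * lam j * trd / n%:R) / gap j); last first.
        by field; rewrite !gt_eqF.
      rewrite ler_pdivlMr//; have := sqr_ge0 (gap j); nra.
    rewrite ler_wpM2r ?divr_ge0 ?(ltW lj) ?(ltW g0)// ler_wpM2l//.
    by rewrite lerDl mulr_ge0// ltW.
  have : gap j <= 2 * C3 * a * t / r.
    rewrite -(@ler_pXn2r _ 2)//; last 2 first.
    - by rewrite nnegrE ltW.
    - by rewrite nnegrE divr_ge0 ?(ltW r0)// !mulr_ge0 ?(ltW C3_gt0) ?(ltW a0).
    apply: le_trans hg _; rewrite -aa -tt -rr le_eqVlt; apply/orP; left.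
    by apply/eqP; field; rewrite gt_eqF.
  move=> h; apply: (@le_trans _ _ (6 * C3 / r * t * a)).
    rewrite [leRHS](_ : _ = 3 * (2 * C3 * a * t / r)); last by field; rewrite gt_eqF.
    by rewrite ler_wpM2l.
  by rewrite ler_wpM2r ?(ltW a0)// ler_wpM2l// lerDl mulr_ge0// ltW.
- set x := expR _ in hP; exists x.
  set m := n%:R * (gap j / lam j) ^+ 2 / (8 * C3 ^+ 2).
  have yj0 : 0 < gap j / lam j by exact: divr_gt0.
  have m0 : 0 < m by rewrite divr_gt0// mulr_gt0// exprn_gt0.
  have xE : x = expR (- m) * expR (- m).
    rewrite /x -expRD; congr expR; rewrite /m; field.
    by rewrite !gt_eqF.
  (* The ratio of gap to eigenvalue is larger at [j] than at [s], and the constant [8] in [m] leaves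
     room compared with [32]. *)
  have mth : expR (- m) <= th.
    rewrite ler_expR lerN2 /m.
    have hy := gap_ratio_mono _ _ j0 js ps.
    have y0 : 0 <= gap s / lam s by rewrite divr_ge0 ?(ltW gs0)// ltW// lam_gt0.
    have c0 : 0 <= n%:R / (32 * C3 ^+ 2) :> R.
      by rewrite divr_ge0 ?(ltW nR)// mulr_ge0// sqr_ge0.
    apply: (@le_trans _ _ (n%:R / (32 * C3 ^+ 2) * (gap j / lam j) ^+ 2)).
      rewrite [leLHS](_ : _ = n%:R / (32 * C3 ^+ 2) * (gap s / lam s) ^+ 2).
        rewrite ler_wpM2l// ler_pXn2r ?nnegrE//; exact: le_trans hy.
      by field; rewrite !gt_eqF// lam_gt0.
    rewrite [leRHS](_ : _ = 4 * (n%:R / (32 * C3 ^+ 2) * (gap j / lam j) ^+ 2)).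
      have := mulr_ge0 c0 (sqr_ge0 (gap j / lam j)).
      by move: (n%:R / _ * _) => z z0; lra.
    by field; rewrite !gt_eqF.
  have e0 : 0 <= expR (- m) := expR_ge0 _.
  split => //.
    have hm := expRN_le_inv _ m0.
    have xle : x <= m^-1 * th by rewrite xE ler_pM.
    apply: (@le_trans _ _ (24 * C3 ^+ 2 / n%:R * (lam j * th) * (lam j / gap j))).
      rewrite [leRHS](_ : _ = 3 * gap j * (m^-1 * th)); last first.
        by rewrite /m; field; rewrite !gt_eqF.
      by rewrite ler_wpM2l// mulr_ge0// ltW.
    rewrite ler_wpM2r ?divr_ge0 ?(ltW lj) ?(ltW g0)// ler_wpM2l//.
    have : lam j * th <= tr0 * th by rewrite ler_wpM2r// ltW.
    lra.
  pose z := r * (gap j / lam j) / (4 * C3).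
  have z0 : 0 < z by rewrite divr_gt0// mulr_gt0.
  have hz : expR (- m) <= (2 * z)^-1.
    rewrite (_ : m = 2 * z ^+ 2); first exact: expRN_sqr_le_inv.
    by rewrite /m /z -rr; field; rewrite !gt_eqF.
  have xle : x <= (2 * z)^-1 * th by rewrite xE ler_pM.
  apply: (@le_trans _ _ (6 * C3 / r * (a * th) * a)).
    rewrite [leRHS](_ : _ = 3 * gap j * ((2 * z)^-1 * th)); last first.
      by rewrite /z -aa; field; rewrite aa !gt_eqF.
    by rewrite ler_wpM2l// mulr_ge0// ltW.
  rewrite ler_wpM2r ?(ltW a0)// ler_wpM2l//.
  have : a * th <= v * th by rewrite ler_wpM2r// ltW.
  lra.
Qed.

Let K_ge1 : 1 <= K. Proof. exact: moment_constant_ge1. Qed.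

(** If [g] is at most [e], the first entry of the minimum suffices; otherwise [g] may be replaced by
    [e] in the denominator. *)
Lemma min_div_le (g k e r : R) : 0 < e -> 0 <= k -> 0 <= r ->
  Num.min g (k / g * r) <= k / e * r + e.
Proof.
move=> e0 k0 r0.
have h : 0 <= k / e * r by rewrite mulr_ge0// divr_ge0// ltW.
have [ge|eg] := leP g e.
  by rewrite ge_min (le_trans ge)// lerDr.
rewrite ge_min; apply/orP; right.
apply: (@le_trans _ _ (k / e * r)); last by rewrite lerDl ltW.
have g0 := lt_trans e0 eg.
by rewrite ler_wpM2r// ler_wpM2l// lef_pV2 ?posrE// ltW.
Qed.

Section Majorants.
Context {s : nat} {trs trd tr0 : R}.
Hypotheses (s_gt0 : (0 < s)%N) (sd : (s <= d)%N).
Hypothesis s_cond : gap_cond C3 n lam d s.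
Hypotheses (trsE : (tr_gt p lam s = trs%:E)%E) (trdE : (tr_gt p lam d = trd%:E)%E).
Hypothesis tr0E : (tr_gt p lam 0 = tr0%:E)%E.

Let gs0 : 0 < gap s. Proof. by rewrite subr_gt0; case: s_cond. Qed.
Let ps : in_dim p s. Proof. exact (in_dim_lt pd s_gt0 sd). Qed.
Let th0 : 0 < decay_rate s. Proof. exact: decay_rate_gt0. Qed.
Let pj j : (1 <= j < s.+1)%N -> in_dim p j.
Proof. by move=> /andP[j0 js]; apply: in_dim_le ps. Qed.
Let gj0 j : (1 <= j < s.+1)%N -> 0 < gap j.
Proof.
by move=> /andP[j0 js]; apply: (lt_le_trans gs0); rewrite lerD2r (eigen_le S_eig).
Qed.
Let trd0 : 0 <= trd.
Proof. by rewrite -lee_fin -trdE (tr_gt_ge0). Qed.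
Let tr00 : 0 <= tr0.
Proof. by rewrite -lee_fin -tr0E (tr_gt_ge0). Qed.
Let trds : trd <= trs.
Proof. by rewrite -lee_fin -trdE -trsE (tr_gt_le). Qed.

Lemma tail_masses : exists pi : nat -> R, forall j, (1 <= j < s.+1)%N ->
  [/\ (P (tail_event j) <= (pi j)%:E)%E,
    3 * gap j * pi j <=
      24 * C3 ^+ 2 / n%:R * (trd + tr0 * decay_rate s) * (lam j / gap j) &
    3 * gap j * pi j <= 6 * C3 / Num.sqrt n%:R *
      (Num.sqrt trd + Num.sqrt tr0 * decay_rate s) * Num.sqrt (lam j)].
Proof.
have /choice[pi hpi] : forall j, exists x, (1 <= j < s.+1)%N ->
  [/\ (P (tail_event j) <= x%:E)%E,
    3 * gap j * x <= 24 * C3 ^+ 2 / n%:R * (trd + tr0 * decay_rate s) * (lam j / gap j) &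
    3 * gap j * x <= 6 * C3 / Num.sqrt n%:R *
      (Num.sqrt trd + Num.sqrt tr0 * decay_rate s) * Num.sqrt (lam j)].
  move=> j; have [jS|] := boolP (1 <= j < s.+1)%N; last by exists 0.
  have /andP[j0 js] := jS.
  have [x hx] := tail_event_mass s j trd tr0 trdE tr0E j0 js sd gs0.
  by exists x.
by exists pi.
Qed.

Let Pbad : (P (weighted_event s) <= (decay_rate s ^+ 2)%:E)%E.
Proof.
rewrite decay_rate_sqr.
exact: (probability_weighted_event _ s_gt0 sd s_cond).
Qed.

Lemma local_majorant : exists G : Om -> R, [/\ measurable_fun setT G,
  forall w, subspace_error s w <= G w &
  (\int[P]_w (G w)%:E <= ((24 * C3 ^+ 2 + 16 * K) / n%:R *
    (trs + tr0 * decay_rate s) * gap_sum lam d s)%:E)%E].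
Proof.
have [pi hpi] := tail_masses.
have [||||G [mG eG iG]] := subspace_error_majorant s (decay_rate s) trs tr0 pi
  (fun j => 8 / gap j) (fun=> 0) (fun j => 4 / gap j) (fun=> 0)
  s_gt0 sd gs0 th0 Pbad trsE tr0E.
- by move=> j /hpi[].
- by move=> j /gj0 /ltW g0; rewrite !divr_ge0.
- by move=> j r _ r0; rewrite addr0 ge_min lexx orbT.
- by move=> j r _ r0; rewrite addr0 ge_min lexx orbT.
exists G; split => //; apply: (le_trans iG); rewrite lee_fin /gap_sum mulr_sumr.
rewrite big_nat_cond [leRHS]big_nat_cond; apply: ler_sum => j /andP[jS _].
have [_ h _] := hpi j jS.
have g0 := gj0 _ jS; have l0 := lam_gt0 _ (pj _ jS).
have q0 : 0 < lam j / gap j / n%:R by rewrite !divr_gt0.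
have ht : 24 * C3 ^+ 2 / n%:R * (trd + tr0 * decay_rate s) * (lam j / gap j) <=
    24 * C3 ^+ 2 * (trs + tr0 * decay_rate s) * (lam j / gap j / n%:R).
  rewrite [leLHS](_ : _ = 24 * C3 ^+ 2 * (trd + tr0 * decay_rate s) *
    (lam j / gap j / n%:R)).
    by rewrite ler_wpM2r ?(ltW q0)// ler_wpM2l ?lerD2r// mulr_ge0// sqr_ge0.
  by field; rewrite !gt_eqF.
apply: le_trans (lerD (lerD (le_trans h ht) (lexx _)) (lexx _)) _.
rewrite !addr0 mul0r addr0 -/K.
have tt0 : 0 <= tr0 * decay_rate s by rewrite mulr_ge0// ltW.
(* The exceptional event contributes only [4 * K] where [16 * K] is allowed; the difference is the
   surplus displayed here. *)
rewrite -subr_ge0 [leRHS](_ : _ = 12 * K * (tr0 * decay_rate s) * (lam j / gap j / n%:R)).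
  have K0 : 0 <= K by rewrite (le_trans _ K_ge1).
  by rewrite (mulr_ge0 _ (ltW q0))// mulr_ge0// mulr_ge0.
by field; rewrite !gt_eqF.
Qed.

Lemma global_majorant : exists G : Om -> R, [/\ measurable_fun setT G,
  forall w, subspace_error s w <= G w &
  (\int[P]_w (G w)%:E <= ((6 * C3 + 8 * K + 4) / Num.sqrt n%:R *
    (Num.sqrt trs + Num.sqrt tr0 * decay_rate s) *
    \sum_(1 <= j < s.+1) Num.sqrt (lam j))%:E)%E].
Proof.
have [pi hpi] := tail_masses.
have ps1 : in_dim p s.+1 by apply: (in_dim_le p _ _ pd).
have trs0 : 0 < trs.
  by apply: lt_le_trans (lam_gt0 _ ps1) _; rewrite -lee_fin -trsE (lam_le_tr_gt).
have tr0_gt0 : 0 < tr0.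
  by apply: lt_le_trans trs0 _; rewrite -lee_fin -trsE -tr0E (tr_gt_le).
have r0 : 0 < Num.sqrt (n%:R : R) by rewrite sqrtr_gt0.
have t0 : 0 < Num.sqrt trs by rewrite sqrtr_gt0.
have v0 : 0 < Num.sqrt tr0 by rewrite sqrtr_gt0.
have td : Num.sqrt trd <= Num.sqrt trs by rewrite ler_wsqrtr.
have rr : Num.sqrt (n%:R : R) ^+ 2 = n%:R by rewrite sqr_sqrtr// ltW.
have tt : Num.sqrt trs ^+ 2 = trs by rewrite sqr_sqrtr// ltW.
have vv : Num.sqrt tr0 ^+ 2 = tr0 by rewrite sqr_sqrtr// ltW.
set r := Num.sqrt (n%:R : R) in r0 rr hpi *.
set t := Num.sqrt trs in t0 tt td *; set v := Num.sqrt tr0 in v0 vv hpi *.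
clearbody r t v.
(* The scales [c j] and [c' j] are the square roots of [lam j * trs / n] and [lam j * tr0 / n], the
   orders of the residuals for [s] and for [0]. Dividing [c' j] by [decay_rate s] below makes its
   product with the squared rate equal to [c' j * decay_rate s]. *)
pose c j := Num.sqrt (lam j) * t / r.
pose c' j := Num.sqrt (lam j) * v / r.
have sl j : (1 <= j < s.+1)%N -> 0 < Num.sqrt (lam j).
  by move=> /pj pjj; rewrite sqrtr_gt0 lam_gt0.
have c0 j : (1 <= j < s.+1)%N -> 0 < c j.
  by move=> jS; rewrite divr_gt0// mulr_gt0// sl.
have c'0 j : (1 <= j < s.+1)%N -> 0 < c' j.
  by move=> jS; rewrite divr_gt0// mulr_gt0// sl.
have [||||G [mG eG iG]] := subspace_error_majorant s (decay_rate s) trs tr0 pi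
  (fun j => 8 / (2 * c j)) (fun j => 2 * c j)
  (fun j => 4 / (c' j / decay_rate s)) (fun j => c' j / decay_rate s)
  s_gt0 sd gs0 th0 Pbad trsE tr0E.
- by move=> j /hpi[].
- move=> j jS; have c1 := ltW (c0 j jS); have c2 := ltW (c'0 j jS).
  have th1 := ltW th0.
  by split; [rewrite divr_ge0// mulr_ge0|rewrite mulr_ge0|
    rewrite divr_ge0// divr_ge0|rewrite divr_ge0].
- move=> j y jS y0; apply: min_div_le => //.
  by rewrite mulr_gt0// c0.
- move=> j y jS y0; apply: min_div_le => //.
  by rewrite divr_gt0// c'0.
exists G; split => //; apply: (le_trans iG); rewrite lee_fin mulr_sumr.
rewrite big_nat_cond [leRHS]big_nat_cond; apply: ler_sum => j /andP[jS _].
have [_ _ h] := hpi j jS.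
have aa : Num.sqrt (lam j) ^+ 2 = lam j by rewrite sqr_sqrtr// ltW// lam_gt0// pj.
have a0 := sl j jS; rewrite /c /c' in c0 c'0 *.
set a := Num.sqrt (lam j) in a0 aa h *; clearbody a.
have ar0 : 0 < a / r by rewrite divr_gt0.
have ht : 6 * C3 / r * (Num.sqrt trd + v * decay_rate s) * a <=
    6 * C3 * (t + v * decay_rate s) * (a / r).
  rewrite [leLHS](_ : _ = 6 * C3 * (Num.sqrt trd + v * decay_rate s) * (a / r)).
    by rewrite ler_wpM2r ?(ltW ar0)// ler_wpM2l ?lerD2r// mulr_ge0// ltW.
  by field; rewrite gt_eqF.
apply: le_trans (lerD (lerD (le_trans h ht) (lexx _)) (lexx _)) _.
have K0 : 0 <= K by rewrite (le_trans _ K_ge1).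
have th1 : decay_rate s <= 1 by exact: decay_rate_le1.
have vr0 : 0 <= v * decay_rate s by rewrite mulr_ge0// ltW.
rewrite -/K -aa -rr -tt -vv -subr_ge0.
rewrite [leRHS](_ : _ =
  (8 * K + 3 - 4 * K * decay_rate s) * (v * decay_rate s) * (a / r)).
  rewrite mulr_ge0 ?(ltW ar0)// mulr_ge0//; have := th0; nra.
by field; rewrite !gt_eqF.
Qed.

End Majorants.

(** Every term of the gap sum is at most [lam j / gap j], so failure of the condition forces
    [n / (16 C3^2) < j (lam j / gap j)^2]. A nonpositive gap satisfies the bound trivially. *)
Lemma gap_cond_fail j : (0 < j)%N -> (j <= d)%N -> ~ gap_cond C3 n lam d j ->
  gap j <= 4 * C3 / Num.sqrt n%:R * (lam j * Num.sqrt j%:R).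
Proof.
move=> j0 jd ncond.
have pj : in_dim p j := in_dim_lt pd j0 jd.
have lj := lam_gt0 _ pj.
have r0 : 0 < Num.sqrt (n%:R : R) by rewrite sqrtr_gt0.
have q0 : 0 < Num.sqrt (j%:R : R) by rewrite sqrtr_gt0 ltr0n.
have rhs0 : 0 <= 4 * C3 / Num.sqrt n%:R * (lam j * Num.sqrt j%:R).
  by rewrite mulr_ge0 ?divr_ge0 ?mulr_ge0 ?ltW.
have [g0|/le_trans->//] := ltP 0 (gap j).
have hn : n%:R / (16 * C3 ^+ 2) < lam j / gap j * gap_sum lam d j.
  rewrite ltNge; apply/negP => h; apply: ncond; split => //.
  by rewrite -subr_gt0.
have hs : gap_sum lam d j <= j%:R * (lam j / gap j).
  have -> : j%:R * (lam j / gap j) = \sum_(1 <= i < j.+1) (lam j / gap j).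
    by rewrite sumr_const_nat subn1 mulr_natl.
  rewrite /gap_sum big_nat_cond [leRHS]big_nat_cond.
  apply: ler_sum => i /andP[/andP[i0 ij] _].
  have pi : in_dim p i by apply: (in_dim_le p i0 ij).
  have gi : 0 < gap i by apply: (lt_le_trans g0); rewrite lerD2r (eigen_le S_eig).
  rewrite -[leLHS]invf_div -[leRHS]invf_div lef_pV2 ?posrE ?divr_gt0 ?lam_gt0//.
  exact: (gap_ratio_mono).
have lg0 : 0 < lam j / gap j by exact: divr_gt0.
have {hs}hn := lt_le_trans hn (ler_wpM2l (ltW lg0) hs).
rewrite -(@ler_pXn2r _ 2)// ?nnegrE ?(ltW g0)//.
have rr : Num.sqrt (n%:R : R) ^+ 2 = n%:R by rewrite sqr_sqrtr// ltW.
have qq : Num.sqrt (j%:R : R) ^+ 2 = j%:R by rewrite sqr_sqrtr.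
have -> : (4 * C3 / Num.sqrt n%:R * (lam j * Num.sqrt j%:R)) ^+ 2 =
    16 * C3 ^+ 2 / n%:R * (lam j ^+ 2 * j%:R).
  rewrite -[in RHS]rr -[in RHS]qq.
  by move: (Num.sqrt n%:R) (Num.sqrt j%:R) r0 => a b a0; field; rewrite gt_eqF.
rewrite [leRHS](_ : _ = 16 * C3 ^+ 2 / n%:R * gap j ^+ 2 *
  (lam j / gap j * (j%:R * (lam j / gap j)))); last first.
  by field; rewrite !gt_eqF.
have c0 : 0 < 16 * C3 ^+ 2 / n%:R * gap j ^+ 2.
  by rewrite mulr_gt0 ?exprn_gt0// divr_gt0// mulr_gt0// exprn_gt0.
rewrite [leLHS](_ : _ = 16 * C3 ^+ 2 / n%:R * gap j ^+ 2 *
  (n%:R / (16 * C3 ^+ 2))); last by field; rewrite !gt_eqF.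
by rewrite ler_wpM2l// ltW.
Qed.

(* AM-GM with weight [tau = (sum sqrt lam) / sqrt trs] in [sqrt j <= (tau + j / tau) / 2],
   together with [j sqrt (lam j) <= sum_(i <= j) sqrt (lam i)]. *)
Lemma gap_tail_bound s (trs : R) : (s <= d)%N ->
  (forall j, (s < j)%N -> (j <= d)%N -> ~ gap_cond C3 n lam d j) ->
  (tr_gt p lam s = trs%:E)%E ->
  \sum_(s.+1 <= j < d.+1) gap j <= 4 * C3 / Num.sqrt n%:R *
    Num.sqrt trs * \sum_(1 <= j < d.+1) Num.sqrt (lam j).
Proof.
move=> sd ncond trsE.
have ps1 : in_dim p s.+1 by apply: (in_dim_le p _ _ pd).
have trs0 : 0 < trs.
  by apply: lt_le_trans (lam_gt0 _ ps1) _; rewrite -lee_fin -trsE (lam_le_tr_gt).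
set sigma := \sum_(1 <= j < d.+1) _.
have cn0 : 0 <= 4 * C3 / Num.sqrt n%:R by rewrite divr_ge0 ?sqrtr_ge0// mulr_ge0// ltW.
have sigma0 : 0 <= sigma by apply: sumr_ge0 => j _; exact: sqrtr_ge0.
have [sd'|ds] := ltnP s d; last first.
  by rewrite big_geq ?ltnS// mulr_ge0// mulr_ge0// sqrtr_ge0.
have d0 : (0 < d)%N := leq_ltn_trans (leq0n s) sd'.
have psj j : (1 <= j < d.+1)%N -> in_dim p j := in_dim_nat pd.
have sub j : (s.+1 <= j < d.+1)%N -> (1 <= j < d.+1)%N.
  by move=> /andP[sj ->]; rewrite (leq_trans _ sj).
have sigma_gt0 : 0 < sigma.
  rewrite /sigma big_nat_recr//= ltr_wpDl ?sqrtr_gt0 ?lam_gt0//.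
    by apply: sumr_ge0 => j _; exact: sqrtr_ge0.
  by apply: psj; rewrite d0 ltnSn.
have sum_lam : \sum_(s.+1 <= j < d.+1) lam j <= trs.
  rewrite -lee_fin -trsE -sumEFin /tr_gt.
  have -> : (\sum_(s.+1 <= j < d.+1) (lam j)%:E =
     \sum_(s.+1 <= j < d.+1 | in_dim p j) (lam j)%:E)%E.
    rewrite big_nat_cond [RHS]big_nat_cond; apply: eq_bigl => j.
    by case: (boolP (s.+1 <= j < d.+1)%N) => // /sub /psj ->.
  by apply: nneseries_lim_ge => j _ pj; rewrite lee_fin lam_ge0.
have jlam j : (1 <= j < d.+1)%N -> j%:R * lam j <= Num.sqrt (lam j) * sigma.
  move=> jS; have pj := psj j jS; have /andP[j0 jd] := jS.
  have {1}-> : lam j = Num.sqrt (lam j) * Num.sqrt (lam j).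
    by rewrite -expr2 sqr_sqrtr// lam_ge0.
  rewrite mulrCA ler_wpM2l ?sqrtr_ge0//.
  rewrite /sigma (big_cat_nat (n := j.+1))//= ler_wpDr//.
    by apply: sumr_ge0 => i _; exact: sqrtr_ge0.
  have -> : j%:R * Num.sqrt (lam j) = \sum_(1 <= i < j.+1) Num.sqrt (lam j).
    by rewrite sumr_const_nat subn1 mulr_natl.
  rewrite [leLHS]big_nat_cond [leRHS]big_nat_cond.
  apply: ler_sum => i /andP[/andP[i0 ij] _].
  by rewrite ler_wsqrtr// (eigen_le S_eig).
have sum_jlam : \sum_(s.+1 <= j < d.+1) j%:R * lam j <= sigma ^+ 2.
  apply: (@le_trans _ _ (\sum_(1 <= j < d.+1) Num.sqrt (lam j) * sigma)).
    rewrite [leRHS](big_cat_nat (n := s.+1))//=.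
    rewrite ler_wpDl//.
      by apply: sumr_ge0 => j _; rewrite mulr_ge0 ?sqrtr_ge0.
    rewrite [leLHS]big_nat_cond [leRHS]big_nat_cond.
    by apply: ler_sum => j /andP[/sub jS _]; exact: jlam.
  by rewrite -mulr_suml expr2.
set t := Num.sqrt trs.
have t0 : 0 < t by rewrite sqrtr_gt0.
have tt : t ^+ 2 = trs by rewrite sqr_sqrtr// ltW.
pose tau := sigma / t.
have tau0 : 0 < tau by exact: divr_gt0.
apply: (@le_trans _ _ (4 * C3 / Num.sqrt n%:R * \sum_(s.+1 <= j < d.+1)
   ((tau / 2) * lam j + (2 * tau)^-1 * (j%:R * lam j)))).
  rewrite mulr_sumr big_nat_cond [leRHS]big_nat_cond.
  apply: ler_sum => j /andP[jS _]; have /andP[sj jd] := jS.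
  have j0 : (0 < j)%N := leq_ltn_trans (leq0n s) sj.
  apply: le_trans (gap_cond_fail _ j0 jd (ncond _ sj jd)) _.
  rewrite ler_wpM2l//.
  have qq : Num.sqrt (j%:R : R) ^+ 2 = j%:R by rewrite sqr_sqrtr.
  rewrite -[in leRHS]qq; move: (Num.sqrt (j%:R : R)) => q.
  have l0 := lam_gt0 _ (psj _ (sub _ jS)).
  rewrite -subr_ge0 [leRHS](_ : _ = lam j * ((tau - q) ^+ 2 / (2 * tau))).
    by rewrite mulr_ge0 ?(ltW l0)// divr_ge0 ?sqr_ge0// mulr_ge0// ltW.
  by field; rewrite gt_eqF.
rewrite big_split/= -!mulr_sumr -[leRHS]mulrA ler_wpM2l//.
apply: (@le_trans _ _ (tau / 2 * trs + (2 * tau)^-1 * sigma ^+ 2)).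
  apply: lerD; first by rewrite ler_wpM2l// divr_ge0// ltW.
  by rewrite ler_wpM2l// invr_ge0 mulr_ge0// ltW.
clearbody t; rewrite /tau -tt le_eqVlt; apply/orP; left; apply/eqP; field.
by rewrite !gt_eqF.
Qed.

End Concentration.

(* No measurability is needed, since the integral of a nonnegative function is a
   supremum over the simple functions below it. *)
Lemma le_integral_ge0 {d} {T : measurableType d} {R : realType}
    (mu : {measure set T -> \bar R}) (f g : T -> \bar R) :
  (forall x, 0 <= f x)%E -> (forall x, f x <= g x)%E ->
  (\int[mu]_x f x <= \int[mu]_x g x)%E.
Proof.
move=> f0 fg; have g0 x : (0 <= g x)%E by exact: le_trans (f0 x) (fg x).
rewrite !ge0_integralTE//; apply: ereal_sup_le => _ [h hf <-].
by exists h => // x; exact: le_trans (hf x) (fg x).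
Qed.

(* c1 <= 1 follows from the gap hypothesis unless lambda_d = lambda_p, where that
   hypothesis would otherwise hold for arbitrarily large c1 and the global bound
   would force the expected excess risk to be <= 0. *)
Theorem theorem2p11 (R : realType) (C1 C3 : R) (hC3 : 1 < C3)
    (hconc : is_concentration_constant C1 C3) :
  exists2 C : R, 0 < C &
  forall (H : hilbertType R) (p : option nat)
    (dOm : measure_display) (Om : measurableType dOm) (P : probability Om R)
    (X : {RV P >-> borel H}) (Sigma : H -> H)
    (lam : nat -> R) (u : nat -> H)
    (n : nat) (Xs : 'I_n -> {RV P >-> borel H})
    (lamhat : nat -> Om -> R) (uhat : nat -> {RV P >-> borel H})
    (d : nat) (c1 : R),
  separable H ->
  is_mean P X 0 -> sq_integrable P X -> is_covariance P X Sigma ->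
  is_eigensystem p Sigma lam u -> (forall j, in_dim p j -> 0 < lam j) ->
  (1 <= n)%N -> iid_copies X Xs ->
  (forall w, is_eigensystem p (emp_cov Xs w)
               (fun j => lamhat j w) (fun j => uhat j w)) ->
  (forall w j, in_dim p j -> 0 <= lamhat j w) ->
  (1 <= d)%N -> in_dim p d.+1 ->
  sub_gaussian P C1 X ->
  0 < c1 -> c1 <= 1 ->
  c1 * (lam d - eig_last p lam) <= lam d - lam d.+1 ->
  let risk := ('E_P[fun w => excess_risk p u Sigma
                              (fun j => uhat j w) d])%E in
  let decay s := expR (- (c1 ^+ 2 * n%:R * (lam s - eig_last p lam) ^+ 2
                          / (C * lam s ^+ 2))) in
  (gap_cond C3 n lam d d ->
    (risk <= (C / (c1 * n%:R))%:E
             * (tr_gt p lam d + trace p u Sigma * (decay d)%:E)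
             * (gap_sum lam d d)%:E)%E)
  /\
  (forall s : nat, is_largest_index (gap_cond C3 n lam d) d s ->
    (risk <= (C / (c1 * Num.sqrt n%:R))%:E
             * (sqrte (tr_gt p lam s)
                + (if s == 0%N then 0
                   else sqrte (trace p u Sigma) * (decay s)%:E))
             * (\sum_(1 <= j < d.+1) Num.sqrt (lam j))%:E)%E).
Proof.
have K1 := moment_constant_ge1 hC3.
set K := moment_constant in K1.
have C30 : 0 < C3 by exact: lt_trans hC3.
(* The first summand dominates the denominator [32 * C3 ^+ 2] of the decay rate. The total also
   dominates the prefactors of both bounds, since [C3] exceeds [1]. *)
pose C := 32 * C3 ^+ 2 + 16 * K.
have C0 : 0 < C by rewrite /C; have := exprn_gt0 2 C30; lra.
exists C => // H p dOm Om P X S lam u n Xs lamhat uhat d c1 H_sep X_mean X_sq X_cov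
  S_eig lam_gt0 n_gt0 Xs_iid hat_eig lamhat_ge0 d_gt0 pd X_sg c10 c11 hgap risk decay.
have S_sym := covariance_symmetric _ _ X_cov.
have u_onb : is_onb p u by case: S_eig.
have nR : 0 < n%:R :> R by rewrite ltr0n.
have lam_ge0 j : in_dim p j -> 0 <= lam j by move=> /lam_gt0/ltW.
set lp := eig_last p lam in hgap decay *.
have lp_le j : in_dim p j -> lp <= lam j.
  rewrite /lp /eig_last; case: p pd S_eig lam_ge0
    {u_onb hat_eig lamhat_ge0 lam_gt0 hgap lp risk decay} => [q|] pd S_eig lam_ge0 pj;
    last exact: lam_ge0.
  have /andP[j0 jq] := pj.
  apply: (eigen_le S_eig) => //; rewrite /in_dim leqnn andbT.
  exact: leq_trans jq.
(* The hypothesis for [d] extends to smaller indices by adding [lam j - lam d] on the right and [c1]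
   times it on the left, where [c1 <= 1] enters. *)
have gap_le j : (0 < j)%N -> (j <= d)%N -> c1 * (lam j - lp) <= lam j - lam d.+1.
  move=> j0 jd.
  have ljd : lam d <= lam j by rewrite (eigen_le S_eig)// (in_dim_lt pd).
  have : c1 * (lam j - lam d) <= lam j - lam d by rewrite ler_piMl// subr_ge0.
  by move: hgap; rewrite !mulrBr; lra.
pose err s w := subspace_error (lam := lam) (u := u) (d := d)
  (uhat := fun j w => uhat j w : H) s w.
have risk_bounds w : 0 <= excess_risk p u S (fun j => uhat j w) d <= c1^-1 * err d w.
  have hat_onb : is_onb p (fun j => uhat j w : H) by case: (hat_eig w).
  have /andP[-> /le_trans h] := excess_risk_bounds S_eig hat_onb pd lp lam_ge0 lp_le.
  apply: h; rewrite /err /subspace_error mulr_sumr big_nat_cond [leRHS]big_nat_cond.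
  apply: ler_sum => j /andP[/andP[j0 jd] _].
  by rewrite [leRHS]mulrA ler_wpM2r ?sqr_ge0// ler_pdivlMl// gap_le.
have risk_le (G : Om -> R) (B : R) : measurable_fun setT G ->
    (forall w, err d w <= G w) -> (\int[P]_w (G w)%:E <= B%:E)%E ->
    (risk <= (c1^-1 * B)%:E)%E.
  move=> mG eG iG; rewrite /risk unlock.
  have e0 w : 0 <= G w.
    apply: le_trans (eG w).
    have /andP[h1 h2] := risk_bounds w.
    by move: (le_trans h1 h2); rewrite pmulr_rge0// invr_gt0.
  apply: (@le_trans _ _ (\int[P]_w ((c1^-1)%:E * (G w)%:E))%E).
    apply: le_integral_ge0 => w; have /andP[h1 h2] := risk_bounds w.
      by rewrite lee_fin.
    by rewrite -EFinM lee_fin (le_trans h2)// ler_wpM2l// invr_ge0 ltW.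
  rewrite ge0_integralZl_EFin//; last 3 first.
  - by move=> w _; rewrite lee_fin.
  - exact/measurable_EFinP.
  - by rewrite invr_ge0 ltW.
  by rewrite EFinM lee_wpmul2l// lee_fin invr_ge0 ltW.
have trE : trace p u S = tr_gt p lam 0.
  apply: eq_eseriesr => j pj.
  by rewrite (eigen_inner S_sym S_eig)// u_onb.1// eqxx mulr1.
have tr_fin s : exists2 t : R, 0 <= t & (tr_gt p lam s = t%:E)%E.
  have t0 := tr_gt_ge0 lam_gt0 s.
  have tfin : tr_gt p lam s \is a fin_num.
    rewrite ge0_fin_numE//; apply: le_lt_trans (trace_fin X_cov S_eig lam_gt0 X_sq).
    exact: (tr_gt_le lam_gt0).
  by exists (fine (tr_gt p lam s)); rewrite ?fine_ge0// fineK.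
have [tr0 tr00 tr0E] := tr_fin 0%N.
have [trd trd0 trdE] := tr_fin d.
(* The bound [c1 * (lam s - lp) <= lam s - lam d.+1], once squared, is the source of [c1 ^+ 2] in
   the exponent. *)
have decay_le s : (0 < s)%N -> (s <= d)%N ->
    decay_rate (C3 := C3) (lam := lam) (n := n) (d := d) s <= decay s.
  move=> s0 sd; have ps : in_dim p s := in_dim_lt pd s0 sd.
  have ls := lam_gt0 _ ps.
  have h := gap_le _ s0 sd.
  have h0 : 0 <= c1 * (lam s - lp) by rewrite mulr_ge0 ?(ltW c10)// subr_ge0 lp_le.
  rewrite /decay_rate /decay ler_expR lerN2.
  have C3C : 32 * C3 ^+ 2 <= C by rewrite /C; have := K1; lra.
  have D0 : 0 < 32 * C3 ^+ 2 by rewrite mulr_gt0// exprn_gt0.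
  rewrite [leLHS](_ : _ = n%:R * ((c1 * (lam s - lp)) / lam s) ^+ 2 / C); last first.
    by field; rewrite !gt_eqF.
  apply: ler_pM.
  - by rewrite mulr_ge0// sqr_ge0.
  - by rewrite invr_ge0 ltW.
  - rewrite ler_wpM2l// ler_pXn2r ?nnegrE.
    + by rewrite ler_wpM2r// invr_ge0 ltW.
    + by [].
    + by rewrite divr_ge0// ltW.
    + by rewrite divr_ge0 ?(ltW ls)// (le_trans h0).
  - by rewrite lef_pV2 ?posrE.
have gap0 j : (0 < j)%N -> (j <= d)%N -> 0 <= lam j - lam d.+1.
  by move=> j0 jd; rewrite subr_ge0 (eigen_le S_eig)//; exact: leqW.
split=> [cond_d|s [sd cond_s s_max]].
- have [G [mG eG iG]] := local_majorant hC3 hconc H_sep X_mean X_cov S_eig X_sg n_gt0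
    Xs_iid lam_gt0 pd hat_eig d_gt0 (leqnn d) cond_d trdE trdE tr0E.
  apply: le_trans (risk_le G _ mG eG iG) _.
  rewrite trE trdE tr0E -!(EFinM, EFinD) lee_fin -/K.
  have gs0 : 0 <= gap_sum lam d d.
    rewrite /gap_sum big_nat_cond; apply: sumr_ge0 => j /andP[/andP[j0 jd] _].
    by rewrite divr_ge0 ?gap0// lam_ge0// (in_dim_lt pd).
  have hrate := decay_le d d_gt0 (leqnn d).
  set rt := decay_rate _ in hrate *.
  have rt0 : 0 < rt := decay_rate_gt0 _.
  have hC : (24 * C3 ^+ 2 + 16 * K) * (trd + tr0 * rt) <= C * (trd + tr0 * decay d).
    have C32 : 0 <= C3 ^+ 2 := sqr_ge0 C3.
    apply: ler_pM.
    + by have := K1; lra.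
    + by rewrite addr_ge0// mulr_ge0// ltW.
    + by rewrite /C; lra.
    + by rewrite lerD2l ler_wpM2l.
  rewrite [leLHS](_ : _ = (c1 * n%:R)^-1 *
     ((24 * C3 ^+ 2 + 16 * K) * (trd + tr0 * rt)) * gap_sum lam d d); last first.
    by field; rewrite !gt_eqF.
  rewrite [leRHS](_ : _ = (c1 * n%:R)^-1 *
     (C * (trd + tr0 * decay d)) * gap_sum lam d d); last first.
    by field; rewrite !gt_eqF.
  by rewrite ler_wpM2r// ler_wpM2l// invr_ge0 mulr_ge0 ?(ltW c10)// ltW.
have [trs trs0 trsE] := tr_fin s.
set r := Num.sqrt (n%:R : R).
have r0 : 0 < r by rewrite sqrtr_gt0.
set sigma := \sum_(1 <= j < d.+1) Num.sqrt (lam j).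
have sigma0 : 0 <= sigma by apply: sumr_ge0 => j _; exact: sqrtr_ge0.
(* By maximality of [s] the condition fails at every index from [s.+1] to [d]; there the projection
   error is bounded by [1], which leaves a deterministic sum of gaps. *)
have hD : \sum_(s.+1 <= j < d.+1) (lam j - lam d.+1) <=
    4 * C3 / r * Num.sqrt trs * sigma.
  apply: (gap_tail_bound hC3 S_eig n_gt0 lam_gt0 pd s trs sd) => // j sj jd.
  move=> /(s_max j); rewrite (leq_ltn_trans (leq0n s) sj) jd => /(_ isT).
  by rewrite leqNgt sj.
set D := \sum_(s.+1 <= j < d.+1) _ in hD.
have D0 : 0 <= D.
  rewrite /D big_nat_cond; apply: sumr_ge0 => j /andP[/andP[sj jd] _].
  by rewrite gap0// (leq_ltn_trans _ sj).
have errD w : err d w <= err s w + D.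
  rewrite /err /subspace_error (big_cat_nat (n := s.+1))//= lerD2l /D.
  rewrite [leLHS]big_nat_cond [leRHS]big_nat_cond.
  apply: ler_sum => j /andP[/andP[sj jd] _].
  have j0 : (0 < j)%N := leq_ltn_trans (leq0n s) sj.
  rewrite ler_piMr ?gap0//.
  exact: (norm_compl_basis_le1 S_eig pd (hat_eig w) _ (in_dim_lt pd j0 jd)).
pose rt := decay_rate (C3 := C3) (lam := lam) (n := n) (d := d) s.
have rt0 : 0 < rt := decay_rate_gt0 _.
(* For [s = 0] the random part of the error is an empty sum, so only the deterministic gaps remain
   and no exponential term arises. *)
pose A := if s == 0%N then 0 else (6 * C3 + 8 * K + 4) / r *
    (Num.sqrt trs + Num.sqrt tr0 * rt) * sigma.
have [G [mG eG iG]] : exists G : Om -> R, [/\ measurable_fun setT G,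
    forall w, err s w <= G w & (\int[P]_w (G w)%:E <= A%:E)%E].
  rewrite /A; case: posnP => [s0|s_gt0].
    exists (cst 0); split; first exact: measurable_cst.
      by move=> w; rewrite /err /subspace_error s0 big_geq.
    by rewrite integral0_eq.
  have [G [mG eG iG]] := global_majorant hC3 hconc H_sep X_mean X_cov S_eig X_sg
    n_gt0 Xs_iid lam_gt0 pd hat_eig s_gt0 sd (cond_s s_gt0) trsE trdE tr0E.
  exists G; split => //; apply: le_trans iG _; rewrite lee_fin ler_wpM2l//.
    have rs0 : 0 <= Num.sqrt trs + Num.sqrt tr0 * rt.
      by rewrite addr_ge0 ?sqrtr_ge0// mulr_ge0 ?sqrtr_ge0// ltW.
    rewrite mulr_ge0// divr_ge0 ?(ltW r0)//.
    by have := K1; have := C30; rewrite -/K; lra.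
  rewrite /sigma [leRHS](big_cat_nat (n := s.+1))//= lerDl.
  by apply: sumr_ge0 => j _; exact: sqrtr_ge0.
have err0 w : 0 <= err s w.
  rewrite /err /subspace_error big_nat_cond.
  apply: sumr_ge0 => j /andP[/andP[j0 js] _].
  by rewrite mulr_ge0 ?sqr_ge0// gap0//; exact: leq_trans sd.
have iGD : (\int[P]_w (G w + D)%:E <= (A + D)%:E)%E.
  under eq_integral do rewrite EFinD.
  rewrite ge0_integralD//=; last 2 first.
  - by move=> w _; rewrite lee_fin (le_trans (err0 w)).
  - exact/measurable_EFinP.
  rewrite integral_cst//= [P _]probability_setT mule1 EFinD.
  by rewrite leeD2r.
have mGD : measurable_fun setT (fun w => G w + D).
  by apply: measurable_funD => //; exact: measurable_cst.
have eGD w : err d w <= G w + D by rewrite (le_trans (errD w))// lerD2r.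
apply: le_trans (risk_le _ _ mGD eGD iGD) _.
rewrite trE trsE tr0E.
have C31 : C3 <= C3 ^+ 2 by rewrite expr2 ler_peMl// ltW.
have t0 := sqrtr_ge0 trs; have v0 := sqrtr_ge0 tr0.
rewrite /A; case: posnP => [s0|s_gt0].
  rewrite adde0 -!EFinM lee_fin add0r.
  apply: (@le_trans _ _ (c1^-1 * (4 * C3 / r * Num.sqrt trs * sigma))).
    by rewrite ler_wpM2l// invr_ge0 ltW.
  rewrite [leLHS](_ : _ = (4 * C3) * (Num.sqrt trs * sigma / (c1 * r))); last first.
    by field; rewrite !gt_eqF.
  rewrite [leRHS](_ : _ = C * (Num.sqrt trs * sigma / (c1 * r))); last first.
    by field; rewrite !gt_eqF.
  have z0 : 0 <= Num.sqrt trs * sigma / (c1 * r).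
    by rewrite divr_ge0// mulr_ge0// ?(ltW c10)// ltW.
  have C4 : 4 * C3 <= C by rewrite /C; move: K1 C30 C31; lra.
  by rewrite ler_wpM2r.
rewrite /= -!(EFinM, EFinD) lee_fin.
have hrate : rt <= decay s := decay_le s s_gt0 sd.
have vd : Num.sqrt tr0 * rt <= Num.sqrt tr0 * decay s by rewrite ler_wpM2l.
have vd0 : 0 <= Num.sqrt tr0 * rt by rewrite mulr_ge0// ltW.
apply: (@le_trans _ _ (c1^-1 * ((6 * C3 + 8 * K + 4) / r *
    (Num.sqrt trs + Num.sqrt tr0 * rt) * sigma + 4 * C3 / r * Num.sqrt trs * sigma))).
  by rewrite ler_wpM2l ?invr_ge0 ?(ltW c10)// lerD2l.
have z0 : 0 <= sigma / (c1 * r) by rewrite divr_ge0// mulr_ge0 ?(ltW c10)// ltW.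
move: vd vd0 t0; move: (Num.sqrt tr0 * rt) (Num.sqrt tr0 * decay s) (Num.sqrt trs).
move=> x y t xy x0 t0.
rewrite [leLHS](_ : _ = ((6 * C3 + 8 * K + 4) * (t + x) + 4 * C3 * t) *
   (sigma / (c1 * r))); last by field; rewrite !gt_eqF.
rewrite [leRHS](_ : _ = C * (t + y) * (sigma / (c1 * r))); last first.
  by field; rewrite !gt_eqF.
rewrite ler_wpM2r//.
have tx0 : 0 <= t + x by rewrite addr_ge0.
(* The coefficient [10] collects [6] from the majorant and [4] from the deterministic gaps. *)
apply: (@le_trans _ _ ((10 * C3 + 8 * K + 4) * (t + x))).
  have : C3 * t <= C3 * (t + x) by rewrite ler_wpM2l ?(ltW C30)// lerDl.
  lra.
apply: ler_pM => //.
- by have := K1; have := C30; lra.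
- by rewrite /C; have := K1; have := C30; have := C31; lra.
- by rewrite lerD2l.
Qed.
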